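(* Let $L$ be a countable signature of continuous logic, let $F$ be a fragment of the infinitary continuous logic $\mathcal{L}_{\omega_1\omega}(L)$, and let $T$ be an $F$-theory all of whose models are almost locally compact. Then the isomorphism relation $\cong_T$ on $\mathrm{Mod}(T)$ is classifiable by countable structures.
   Context: A Polish metric structure in signature $L$ is a complete separable metric space $(M,d)$ (with bounded metric) together with interpretations of the predicate symbols of $L$ as uniformly continuous real-valued functions with the moduli prescribed by $L$. As in the paper, fragments are countable. $\mathrm{Mod}(L)$ denotes the standard Borel space of codes of Polish metric structures: a code describes the values of $d$ and of all predicates on tuples from $\mathbb{N}$, where $\mathbb{N}$ is a tail-dense subset of the structure (every tail $\{n,n+1,\dots\}$ is dense); the coded structure is the completion. An $F$-theory $T$ is a set of $F$-sentences, and $\mathrm{Mod}(T)\subseteq \mathrm{Mod}(L)$ is the set of codes of structures in which every sentence of $T$ takes value $0$. For $M,N\in\mathrm{Mod}(T)$, $M\cong_T N$ iff the coded structures are isomorphic (there is a surjective isometry preserving all predicates). A topological space is almost locally compact if it contains a dense locally compact subspace. An equivalence relation $E$ on a standard Borel space $X$ is classifiable by countable structures if there are a countable relational language $L'$ and a Borel map $f$ from $X$ into the standard Borel space of $L'$-structures with universe $\mathbb{N}$ such that $xEy$ iff $f(x)\cong f(y)$. *)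

(* Defs.v *)
From Stdlib Require Import Reals.
From Stdlib Require Vectors.Fin.
From Coquelicot Require Import Coquelicot.
Open Scope R_scope.

Record signature := {
  Pred : Type;
  pred_code : Pred -> nat;
  pred_code_inj : forall p q, pred_code p = pred_code q -> p = q;
  arity : Pred -> nat;
  modulus : Pred -> R -> R;
  modulus_pos : forall P e, 0 < e -> 0 < modulus P e;
  pbound : Pred -> R;
  dbound : R }.

Record structure (L : signature) := {
  carrier :> Type;
  dist : carrier -> carrier -> R;
  interp : forall P : Pred L, (Fin.t (arity L P) -> carrier) -> R }.
Arguments dist {L} _ _ _.
Arguments interp {L} _ _ _.

Definition cauchy {L} (M : structure L) (u : nat -> M) : Prop :=
  forall e, 0 < e -> exists N, forall n m, (N <= n)%nat -> (N <= m)%nat ->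
    dist M (u n) (u m) < e.

Definition converges_to {L} (M : structure L) (u : nat -> M) (x : M) : Prop :=
  forall e, 0 < e -> exists N, forall n, (N <= n)%nat -> dist M (u n) x < e.

Definition polish {L} (M : structure L) : Prop :=
  (forall x y, 0 <= dist M x y) /\
  (forall x y, dist M x y = 0 <-> x = y) /\
  (forall x y, dist M x y = dist M y x) /\
  (forall x y z, dist M x z <= dist M x y + dist M y z) /\
  (forall x y, dist M x y <= dbound L) /\
  (forall u : nat -> M, cauchy M u -> exists x, converges_to M u x) /\
  (exists s : nat -> M, forall x e, 0 < e -> exists n, dist M (s n) x < e) /\
  (forall P a, Rabs (interp M P a) <= pbound L P) /\
  (forall P e (a b : Fin.t (arity L P) -> M), 0 < e ->
     (forall k, dist M (a k) (b k) < modulus L P e) ->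
     Rabs (interp M P a - interp M P b) <= e).

Definition isomorphic {L} (M N : structure L) : Prop :=
  exists g : M -> N,
    (forall y : N, exists x : M, g x = y) /\
    (forall x y, dist N (g x) (g y) = dist M x y) /\
    (forall P (a : Fin.t (arity L P) -> M),
       interp N P (fun k => g (a k)) = interp M P a).

Inductive formula (L : signature) : Type :=
| F_dist : nat -> nat -> formula L
| F_pred : forall P : Pred L, (Fin.t (arity L P) -> nat) -> formula L
| F_conn : forall n : nat, ((Fin.t n -> R) -> R) -> (Fin.t n -> formula L) -> formula L
| F_sup : nat -> formula L -> formula L
| F_inf : nat -> formula L -> formula L
| F_bigsup : (nat -> formula L) -> formula L
| F_biginf : (nat -> formula L) -> formula L.
Arguments F_dist {L}. Arguments F_pred {L}. Arguments F_conn {L}.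
Arguments F_sup {L}. Arguments F_inf {L}.
Arguments F_bigsup {L}. Arguments F_biginf {L}.

Definition upd {A : Type} (s : nat -> A) (i : nat) (a : A) : nat -> A :=
  fun j => if Nat.eqb j i then a else s j.

Definition rsup (E : R -> Prop) : R := real (Lub_Rbar E).
Definition rinf (E : R -> Prop) : R := real (Glb_Rbar E).

Fixpoint eval {L} (M : structure L) (s : nat -> M) (phi : formula L) : R :=
  match phi with
  | F_dist i j => dist M (s i) (s j)
  | F_pred P v => interp M P (fun k => s (v k))
  | F_conn n u ps => u (fun k => eval M s (ps k))
  | F_sup i p => rsup (fun r => exists m : M, r = eval M (upd s i m) p)
  | F_inf i p => rinf (fun r => exists m : M, r = eval M (upd s i m) p)
  | F_bigsup ps => rsup (fun r => exists n, r = eval M s (ps n))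
  | F_biginf ps => rinf (fun r => exists n, r = eval M s (ps n))
  end.

Inductive free {L} : formula L -> nat -> Prop :=
| fv_dist_l i j : free (F_dist i j) i
| fv_dist_r i j : free (F_dist i j) j
| fv_pred P v k : free (F_pred P v) (v k)
| fv_conn n u ps k x : free (ps k) x -> free (F_conn n u ps) x
| fv_sup i p x : free p x -> x <> i -> free (F_sup i p) x
| fv_inf i p x : free p x -> x <> i -> free (F_inf i p) x
| fv_bigsup ps n x : free (ps n) x -> free (F_bigsup ps) x
| fv_biginf ps n x : free (ps n) x -> free (F_biginf ps) x.

Definition sentence {L} (phi : formula L) : Prop := forall x, ~ free phi x.

Definition continuous_conn (n : nat) (u : (Fin.t n -> R) -> R) : Prop :=
  forall v e, 0 < e -> exists d, 0 < d /\
    forall w, (forall k, Rabs (v k - w k) < d) -> Rabs (u v - u w) < e.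

Definition admissible_family {L} (ps : nat -> formula L) : Prop :=
  (exists K, forall n x, free (ps n) x -> (x < K)%nat) /\
  (exists b, forall (M : structure L) s n, polish M -> Rabs (eval M s (ps n)) <= b) /\
  (exists D : R -> R, (forall e, 0 < e -> 0 < D e) /\
     forall (M : structure L) s t n e, polish M -> 0 < e ->
       (forall x, dist M (s x) (t x) < D e) ->
       Rabs (eval M s (ps n) - eval M t (ps n)) <= e).

Inductive wf {L} : formula L -> Prop :=
| wf_dist i j : wf (F_dist i j)
| wf_pred P v : wf (F_pred P v)
| wf_conn n u ps : continuous_conn n u -> (forall k, wf (ps k)) -> wf (F_conn n u ps)
| wf_sup i p : wf p -> wf (F_sup i p)
| wf_inf i p : wf p -> wf (F_inf i p)
| wf_bigsup ps : (forall n, wf (ps n)) -> admissible_family ps -> wf (F_bigsup ps)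
| wf_biginf ps : (forall n, wf (ps n)) -> admissible_family ps -> wf (F_biginf ps).

Inductive immsub {L} : formula L -> formula L -> Prop :=
| is_conn n u ps k : immsub (ps k) (F_conn n u ps)
| is_sup i p : immsub p (F_sup i p)
| is_inf i p : immsub p (F_inf i p)
| is_bigsup ps n : immsub (ps n) (F_bigsup ps)
| is_biginf ps n : immsub (ps n) (F_biginf ps).

Definition fragment {L} (F : formula L -> Prop) : Prop :=
  (exists e : nat -> formula L, forall phi, F phi -> exists n, e n = phi) /\
  (forall phi, F phi -> wf phi) /\
  (forall i j, F (F_dist i j)) /\
  (forall P v, F (F_pred P v)) /\
  (forall phi psi, F psi -> immsub phi psi -> F phi) /\
  (forall i phi, F phi -> F (F_sup i phi) /\ F (F_inf i phi)).

Definition F_theory {L} (F T : formula L -> Prop) : Prop :=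
  forall phi, T phi -> F phi /\ sentence phi.

Definition models {L} (M : structure L) (T : formula L -> Prop) : Prop :=
  polish M /\ forall phi s, T phi -> eval M s phi = 0.

Definition open_set {L} (M : structure L) (U : M -> Prop) : Prop :=
  forall x, U x -> exists e, 0 < e /\ forall y, dist M x y < e -> U y.

Definition compact_set {L} (M : structure L) (K : M -> Prop) : Prop :=
  forall (I : Type) (U : I -> M -> Prop), (forall i, open_set M (U i)) ->
    (forall x, K x -> exists i, U i x) ->
    exists l : list I, forall x, K x -> exists i, List.In i l /\ U i x.

Definition dense_set {L} (M : structure L) (D : M -> Prop) : Prop :=
  forall x e, 0 < e -> exists y, D y /\ dist M x y < e.

Definition locally_compact_sub {L} (M : structure L) (D : M -> Prop) : Prop :=
  forall x, D x -> exists K e, 0 < e /\ compact_set M K /\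
    (forall y, K y -> D y) /\ (forall y, D y -> dist M x y < e -> K y).

Definition almost_locally_compact {L} (M : structure L) : Prop :=
  exists D, dense_set M D /\ locally_compact_sub M D.

Definition Code (L : signature) : Type :=
  ((nat -> nat -> R) * (forall P : Pred L, (Fin.t (arity L P) -> nat) -> R))%type.

Definition codes {L} (c : Code L) (M : structure L) (a : nat -> M) : Prop :=
  polish M /\
  (forall n x e, 0 < e -> exists m, (n <= m)%nat /\ dist M (a m) x < e) /\
  (forall i j, fst c i j = dist M (a i) (a j)) /\
  (forall P v, snd c P v = interp M P (fun k => a (v k))).

Definition ModT {L} (T : formula L -> Prop) (c : Code L) : Prop :=
  exists (M : structure L) a, codes c M a /\ models M T.

Definition isoT {L} (c c' : Code L) : Prop :=
  exists (M M' : structure L) a a', codes c M a /\ codes c' M' a' /\ isomorphic M M'.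

Inductive sigma_gen {X : Type} (G : (X -> Prop) -> Prop) : (X -> Prop) -> Prop :=
| sg_gen A : G A -> sigma_gen G A
| sg_compl A : sigma_gen G A -> sigma_gen G (fun x => ~ A x)
| sg_union (A : nat -> X -> Prop) : (forall n, sigma_gen G (A n)) ->
    sigma_gen G (fun x => exists n, A n x)
| sg_ext A B : sigma_gen G A -> (forall x, A x <-> B x) -> sigma_gen G B.

Definition code_borel {L} : (Code L -> Prop) -> Prop :=
  sigma_gen (fun A =>
    (exists i j r, forall c, A c <-> fst c i j < r) \/
    (exists P v r, forall c, A c <-> snd c P v < r)).

Record rel_language := {
  Sym : Type;
  sym_code : Sym -> nat;
  sym_code_inj : forall p q, sym_code p = sym_code q -> p = q;
  sarity : Sym -> nat }.

Definition cstructure (L' : rel_language) : Type :=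
  forall s : Sym L', (Fin.t (sarity L' s) -> nat) -> bool.

Definition cstructure_borel {L'} : (cstructure L' -> Prop) -> Prop :=
  sigma_gen (fun A => exists s v, forall x, A x <-> x s v = true).

Definition ciso {L'} (x y : cstructure L') : Prop :=
  exists (p q : nat -> nat), (forall n, q (p n) = n) /\ (forall n, p (q n) = n) /\
    forall s v, y s (fun k => p (v k)) = x s v.

Definition classifiable_by_countable_structures {L}
    (X : Code L -> Prop) (E : Code L -> Code L -> Prop) : Prop :=
  exists (L' : rel_language) (f : Code L -> cstructure L'),
    (forall B, cstructure_borel B ->
       exists A, code_borel A /\ forall c, X c -> (B (f c) <-> A c)) /\
    (forall c c', X c -> X c' -> (E c c' <-> ciso (f c) (f c'))).

(* Main.v *)
(** A piece is a class of tuples of [M] satisfying the open conditions recorded in a list of labels,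
    two tuples being equivalent when a chain of small steps inside the set joins them.  Pieces are open
    and canonically attached to [M], only countably many exist for each list of labels, and they can
    be computed from any dense sequence; the classifying structure is the tree of pieces.

    Conversely, an isomorphism of two trees is a back-and-forth system between pieces.  The danger is
    that, along a branch, the pieces on one side drift away to infinity, since a piece need not be
    relatively compact.  This is where almost local compactness enters: a label may bound the number of
    separated points that a piece has in a totally bounded ball, and below a piece where this bound is
    least possible the projections of all descendants stay dense up to the chosen scale.  Hence
    tuples can be chosen convergent on both sides of a generic branch, and their limits are dense
    sequences with the same distances and predicate values. *)

From Stdlib Require Import Reals Lra Lia List ZArith Cantor.
From Stdlib Require Import Classical ClassicalEpsilon FunctionalExtensionality.
Require Import Defs.
Import ListNotations.
Open Scope R_scope.

(** * Tuples and dense maps *)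

(** Tuples of a branch may move inside their pieces, so a coordinate placed near a prescribed point
    need not stay there. Chains repair this: a property that holds at one tuple of a piece and
    survives each short step holds throughout the piece. Density of the limits is obtained in this
    way. A label makes every point of a chain, from the current coordinate to the prescribed point,
    the centre of a totally bounded ball of a fixed radius; later labels fill such a ball around a
    limit with nets, hence with limits; since the steps are short compared with the radius,
    adherence to the set of limits passes from one point of the chain to the next. That projections
    of descendants stay dense is proved along chains as well. For both arguments the steps used
    after [k] labels are shorter than [2^-k], so that padding with free coordinates makes them as
    short as desired. The packing bound has to be a label, not just a property of one tuple, because
    it is applied at another tuple of the same piece, wherever a chain first leaves the vicinity of
    a descendant. *)

Definition pw (n : nat) : R := (/ 2) ^ n.

Lemma pw_pos n : 0 < pw n.
Proof. apply pow_lt; lra. Qed.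

Lemma pw_S n : pw (S n) = pw n / 2.
Proof. unfold pw; simpl; lra. Qed.

Lemma pw_le n m : (n <= m)%nat -> pw m <= pw n.
Proof.
  induction 1 as [|m _ IH]; [lra|].
  rewrite pw_S; pose proof (pw_pos m); lra.
Qed.

Lemma pw_small r : 0 < r -> exists n, pw n < r.
Proof.
  intros Hr.
  destruct (pow_lt_1_zero (/ 2)) with (y := r) as [N HN]; [|exact Hr|].
  - rewrite Rabs_pos_eq; lra.
  - exists N; specialize (HN N (Nat.le_refl N)).
    rewrite Rabs_pos_eq in HN; [exact HN|]; apply Rlt_le, pw_pos.
Qed.

Lemma pw_small_ge r N : 0 < r -> exists n, (N <= n)%nat /\ pw n < r.
Proof.
  intros Hr; destruct (pw_small r Hr) as [n Hn].
  exists (Nat.max N n); split; [lia|].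
  pose proof (pw_le n (Nat.max N n)); apply Rle_lt_trans with (pw n); [|exact Hn].
  apply H; lia.
Qed.

Lemma pw_approx (v : R) c : exists a b : nat,
  Rabs (v - (INR a - INR b) * pw c) < pw c.
Proof.
  pose proof (pw_pos c) as Hc.
  destruct (archimed (v / pw c)) as [H1 H2].
  set (z := up (v / pw c)) in *.
  assert (Hv : v = (v / pw c) * pw c) by (field; lra).
  assert (HR : exists a b : nat, IZR z = INR a - INR b).
  { destruct (Z_le_gt_dec 0 z).
    - exists (Z.to_nat z), 0%nat. rewrite INR_IZR_INZ, Z2Nat.id by lia. simpl; lra.
    - exists 0%nat, (Z.to_nat (- z)). rewrite (INR_IZR_INZ (Z.to_nat _)), Z2Nat.id by lia.
      rewrite opp_IZR; simpl; lra. }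
  destruct HR as [a [b Hab]].
  (* [up] may overshoot by exactly 1, which the strict bound forbids; then [v] is itself a multiple
     of [pw c] and the preceding integer is exact. *)
  destruct (Req_dec (IZR z - v / pw c) 1) as [E|NE].
  - exists a, (S b). rewrite S_INR.
    replace (v - (INR a - (INR b + 1)) * pw c) with 0; [rewrite Rabs_R0; lra|].
    rewrite Hv at 1. replace (v / pw c) with (INR a - INR b - 1) by lra. ring.
  - exists a, b. rewrite <- Hab.
    replace (v - IZR z * pw c) with (- ((IZR z - v / pw c) * pw c)) by (field; lra).
    rewrite Rabs_Ropp, Rabs_pos_eq by nra. nra.
Qed.

(** Tuples grow at the head, so this is the projection to the [n] oldest coordinates. *)
Definition lastn {A} (n : nat) (l : list A) : list A := skipn (length l - n) l.

Lemma lastn_app {A} n (e l : list A) : (n <= length l)%nat -> lastn n (e ++ l) = lastn n l.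
Proof.
  intros H; unfold lastn.
  rewrite skipn_app, length_app, skipn_all2 by lia; simpl.
  f_equal; lia.
Qed.

Lemma lastn_exact {A} n (l : list A) : length l = n -> lastn n l = l.
Proof. intros <-; unfold lastn; now rewrite Nat.sub_diag. Qed.

Lemma lastn_length {A} n (l : list A) : (n <= length l)%nat -> length (lastn n l) = n.
Proof. intros H; unfold lastn; rewrite length_skipn; lia. Qed.

Lemma lastn_split {A} n (l : list A) : l = firstn (length l - n) l ++ lastn n l.
Proof. unfold lastn; symmetry; apply firstn_skipn. Qed.

Lemma lastn_map {A B} (f : A -> B) n l : lastn n (map f l) = map f (lastn n l).
Proof. unfold lastn; now rewrite length_map, skipn_map. Qed.

Lemma nth_rev_app {A} i (e l : list A) d :
  (i < length l)%nat -> nth i (rev (e ++ l)) d = nth i (rev l) d.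
Proof. intros H; rewrite rev_app_distr, app_nth1; [easy|]; now rewrite length_rev. Qed.

(** The number of steps is kept explicit: it carries the inductions along chains and turns
    reachability into a countable union of Borel conditions. *)
Fixpoint reach {T : Type} (R : T -> T -> Prop) (n : nat) (x y : T) : Prop :=
  match n with
  | O => y = x
  | S n => exists u, reach R n x u /\ R u y
  end.

Lemma reach_trans {T} (R : T -> T -> Prop) m n x y z :
  reach R m x y -> reach R n y z -> reach R (n + m) x z.
Proof.
  revert z; induction n as [|n IH]; simpl; intros z Hm Hn; [now subst|].
  destruct Hn as [u [Hu HR]]; exists u; split; [now apply IH|exact HR].
Qed.

Lemma reach_sym {T} (R : T -> T -> Prop) n x y :
  (forall u v, R u v -> R v u) -> reach R n x y -> reach R n y x.
Proof.
  intros Hs; revert y; induction n as [|n IH]; simpl; intros y H; [easy|].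
  destruct H as [u [Hu HR]].
  change (reach R (S n) y x); replace (S n) with (n + 1)%nat by lia.
  apply (reach_trans R 1 n y u x); [|now apply IH].
  exists y; split; [easy|now apply Hs].
Qed.

Record tame {L} (M : structure L) : Prop := {
  tame_refl : forall x, dist M x x = 0;
  tame_sym : forall x y, dist M x y = dist M y x;
  tame_tri : forall x y z, dist M x z <= dist M x y + dist M y z;
  tame_cont : forall P e (a b : Fin.t (arity L P) -> M), 0 < e ->
     (forall k, dist M (a k) (b k) < modulus L P e) ->
     Rabs (interp M P a - interp M P b) <= e }.

Lemma polish_tame {L} (M : structure L) : polish M -> tame M.
Proof.
  intros (_ & H0 & Hs & Ht & _ & _ & _ & _ & Hc).
  split; auto; intros x; now apply H0.
Qed.

(** [A] is meant to be the structure that a code puts on the natural numbers. A coding sequence may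
    repeat points, so [A] is only pseudometric and [f] need not be injective. *)
Record dense_map {L} (A M : structure L) (f : A -> M) : Prop := {
  dm_tame : tame M;
  dm_dist : forall x y, dist M (f x) (f y) = dist A x y;
  dm_interp : forall P v, interp M P (fun k => f (v k)) = interp A P v;
  dm_dense : forall x e, 0 < e -> exists s, dist M x (f s) < e }.

Section Close.
Context {L : signature}.

Definition close (S : structure L) (r : R) : list S -> list S -> Prop :=
  Forall2 (fun a b => dist S a b < r).

Lemma close_length (S : structure L) r x y : close S r x y -> length x = length y.
Proof. apply Forall2_length. Qed.

Lemma close_mono (S : structure L) r r' x y : r <= r' -> close S r x y -> close S r' x y.
Proof. intros H; apply Forall2_impl; intros; lra. Qed.

Lemma close_app (S : structure L) r e w e' w' :
  close S r e e' -> close S r w w' -> close S r (e ++ w) (e' ++ w').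
Proof. apply Forall2_app. Qed.

Lemma close_skipn (S : structure L) r n x y :
  close S r x y -> close S r (skipn n x) (skipn n y).
Proof.
  intros H; revert n; induction H; intros [|n]; simpl; try constructor; auto.
Qed.

Lemma close_lastn (S : structure L) r n x y :
  close S r x y -> close S r (lastn n x) (lastn n y).
Proof.
  intros H; unfold lastn; rewrite (close_length _ _ _ _ H); now apply close_skipn.
Qed.

Lemma close_nth (S : structure L) r x y i d d' :
  close S r x y -> dist S d d' < r -> dist S (nth i (rev x) d) (nth i (rev y) d') < r.
Proof.
  intros H Hd; assert (H' : close S r (rev x) (rev y)).
  { induction H; simpl; [constructor|]. apply close_app; [easy|]. repeat constructor; easy. }
  clear H; revert i; induction H'; intros [|i]; simpl; auto.
Qed.

Section Tame.
Context (M : structure L) (T : tame M).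

Lemma close_refl r x : 0 < r -> close M r x x.
Proof.
  intros Hr; induction x; constructor; [now rewrite (tame_refl M T)|easy].
Qed.

Lemma close_sym r x y : close M r x y -> close M r y x.
Proof. induction 1; constructor; [now rewrite (tame_sym M T)|easy]. Qed.

Lemma close_trans r1 r2 x y z :
  close M r1 x y -> close M r2 y z -> close M (r1 + r2) x z.
Proof.
  intros H; revert z; induction H; intros z Hz; inversion Hz; subst; constructor.
  - pose proof (tame_tri M T x y y0); lra.
  - now apply IHForall2.
Qed.

Lemma close_slack r x y : close M r x y -> exists s, 0 < s /\ close M (r - s) x y.
Proof.
  induction 1 as [|a b x y Hab Hxy IH].
  - exists 1; split; [lra|constructor].
  - destruct IH as [s [Hs Hc]].
    exists (Rmin s ((r - dist M a b) / 2)); split; [apply Rmin_pos; lra|].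
    pose proof (Rmin_l s ((r - dist M a b) / 2)).
    pose proof (Rmin_r s ((r - dist M a b) / 2)).
    constructor; [lra|]. apply close_mono with (r - s); [lra|exact Hc].
Qed.
End Tame.

Section Dense.
Context (A M : structure L) (f : A -> M) (D : dense_map A M f).

Lemma close_map r x y : close M r (map f x) (map f y) <-> close A r x y.
Proof.
  revert y; induction x as [|a x IH]; intros [|b y]; simpl; split; intros H;
    inversion H; subst; constructor; try (now apply IH).
  - now rewrite <- (dm_dist A M f D).
  - now rewrite (dm_dist A M f D).
Qed.

Lemma dense_list (x : list M) r : 0 < r -> exists s, close M r x (map f s).
Proof.
  intros Hr; induction x as [|a x [s Hs]].
  - exists nil; constructor.
  - destruct (dm_dense A M f D a r Hr) as [b Hb].
    exists (b :: s); constructor; easy.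
Qed.

End Dense.
End Close.

(** * Pieces *)

(** All parameters are natural numbers, so there are countably many labels: [a], [b], [c] encode the
    dyadic number [(a - b) * 2^-c], and [Lpred] names a predicate by its code, which keeps labels
    independent of the signature. *)
Inductive label : Type :=
| Lfree
| Ldist (i j a b c : nat)
| Lpred (q : nat) (v : list nat) (a b c : nat)
| Ltb (r : nat)
| Lnet (j D e : nat)
| Lstab (n d k : nat).

Definition near (x : R) (a b c : nat) : Prop :=
  Rabs (x - (INR a - INR b) * pw c) < pw c.

(* Tuples are lists with the newest coordinate first; coordinates are numbered from the oldest. *)
Definition get {A} (b : A) (t : list A) (i : nat) : A := nth i (rev (b :: t)) b.

Section Pieces.
Context {L : signature}.

(** Total boundedness stands in for compactness because it can be tested on a dense subset. Net
    points may lie outside the ball, so they can be moved freely to dense points. *)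
Definition tball (S : structure L) (x : S) (r : R) : Prop :=
  forall e, exists F : list S, forall z, dist S x z < r -> exists y, In y F /\ dist S y z < pw e.

Definition netted (S : structure L) (x : S) (r : R) (u : list S) (e : R) : Prop :=
  forall z, dist S x z < r -> exists y, In y u /\ dist S y z < e.

Definition proj {A} (p : list A -> Prop) (n : nat) (w : list A) : Prop :=
  length w = n /\ exists e, p (e ++ w).

(** A strict bound [k] on the packing number of the projection of [p] near [w], in the maximum
    metric. It fails for [k = 0], the empty list being separated. *)
Definition packed (S : structure L) (p : list S -> Prop) (n : nat) (r s : R) (k : nat)
    (w : list S) : Prop :=
  forall ws, length ws = k ->
    Forall (fun v => proj p n v /\ close S r v w) ws ->
    ~ ForallOrdPairs (fun v v' => ~ close S s v v') ws.

(* The slack [pw h] makes each condition open and determined by any dense subset. *)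
Definition cond (S : structure L) (l : label) (p : list S -> Prop) (b : S) (t : list S)
    : Prop :=
  match l with
  | Lfree => True
  | Ldist i j a a' c => near (dist S (get b t i) (get b t j)) a a' c
  | Lpred q v a a' c => forall P, pred_code L P = q ->
      near (interp S P (fun k => get b t (nth (proj1_sig (Fin.to_nat k)) v 0%nat))) a a' c
  | Ltb r => exists h, tball S b (pw r + pw h)
  | Lnet j D e => exists h, netted S (get b t j) (pw D + pw h) (b :: t) (pw e - pw h)
  | Lstab n d k => exists h, packed S p n (2 * pw d + pw h) (pw d - pw h) k (lastn n t)
  end.

Definition adm (S : structure L) (l : label) (E : list S -> list S -> Prop) (u : list S)
    : Prop :=
  match u with
  | [] => False
  | b :: t => E t t /\ cond S l (E t) b t
  end.

(** Older coordinates may move together with the newest one, but only within one class of [E]; hence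
    each piece lies over a single parent piece. *)
Definition step (S : structure L) (l : label) (E : list S -> list S -> Prop) (r : R)
    (u v : list S) : Prop :=
  adm S l E u /\ adm S l E v /\ E (tl u) (tl v) /\ close S r u v.

(* A partial equivalence relation: [piece S lam x x] says that [x] satisfies the conditions of [lam],
   and the classes are the pieces. *)
Fixpoint piece (S : structure L) (lam : list label) : list S -> list S -> Prop :=
  match lam with
  | [] => fun x y => x = [] /\ y = []
  | l :: lam' => fun x y => adm S l (piece S lam') x /\
      exists n, reach (step S l (piece S lam') (pw (length lam'))) n x y
  end.

Section Tame.
Context (M : structure L) (T : tame M).

Lemma step_sym l E r u v : (forall x y, E x y -> E y x) ->
  step M l E r u v -> step M l E r v u.
Proof.
  intros HE (Hu & Hv & Ht & Hc); repeat split; auto. now apply close_sym.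
Qed.

Lemma piece_adm_r l lam x y : piece M (l :: lam) x y -> adm M l (piece M lam) y.
Proof.
  intros [Hx [[|n] H]]; simpl in H; [now subst|].
  destruct H as [u [_ [_ [Hy _]]]]; exact Hy.
Qed.

Lemma piece_sym lam x y : piece M lam x y -> piece M lam y x.
Proof.
  revert x y; induction lam as [|l lam IH]; intros x y H; [simpl in *; tauto|].
  split; [now apply piece_adm_r with x|].
  destruct H as [_ [n H]]; exists n; apply reach_sym; [|exact H].
  intros u v; now apply step_sym.
Qed.

Lemma piece_trans lam x y z : piece M lam x y -> piece M lam y z -> piece M lam x z.
Proof.
  destruct lam as [|l lam]; [simpl; tauto|].
  intros [Hx [m H]] [_ [n H']]; split; [easy|].
  exists (n + m)%nat; now apply reach_trans with y.
Qed.

Lemma piece_refl_l lam x y : piece M lam x y -> piece M lam x x.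
Proof. intros H; apply piece_trans with y; [easy|now apply piece_sym]. Qed.

Lemma piece_refl_r lam x y : piece M lam x y -> piece M lam y y.
Proof. intros H; apply piece_trans with x; [now apply piece_sym|easy]. Qed.

Lemma piece_class lam x y : piece M lam x y -> forall v, piece M lam x v <-> piece M lam y v.
Proof.
  intros H v; split; intros H'.
  - apply piece_trans with x; [now apply piece_sym|easy].
  - now apply piece_trans with y.
Qed.

Lemma piece_length_l lam x y : piece M lam x y -> length x = length lam.
Proof.
  revert x y; induction lam as [|l lam IH]; intros x y H; [now destruct H as [-> _]|].
  destruct H as [H _]; destruct x as [|b t]; [easy|].
  simpl; f_equal; apply IH with t; apply H.
Qed.

Lemma piece_length_r lam x y : piece M lam x y -> length y = length lam.
Proof. intros H; apply piece_sym in H; now apply piece_length_l in H. Qed.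

Lemma piece_tl l lam x y : piece M (l :: lam) x y -> piece M lam (tl x) (tl y).
Proof.
  intros [Hx [n H]]; revert y H; induction n as [|n IH]; simpl; intros y H.
  - subst. destruct x; [easy|]; apply Hx.
  - destruct H as [u [Hu (_ & _ & Hs & _)]].
    apply piece_trans with (tl u); auto.
Qed.

Lemma piece_app mu lam x y : piece M (mu ++ lam) x y ->
  piece M lam (lastn (length lam) x) (lastn (length lam) y).
Proof.
  revert x y; induction mu as [|l mu IH]; intros x y H.
  - simpl in H. rewrite !lastn_exact; [easy|now apply piece_length_r in H
      |now apply piece_length_l in H].
  - pose proof (piece_length_l _ _ _ H) as Hx; pose proof (piece_length_r _ _ _ H) as Hy.
    simpl in Hx, Hy; rewrite length_app in Hx, Hy.
    destruct x as [|b x], y as [|c y]; try discriminate. simpl in Hx, Hy.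
    change (b :: x) with ([b] ++ x); change (c :: y) with ([c] ++ y).
    rewrite !lastn_app by lia. apply IH. now apply (piece_tl l) in H.
Qed.

Lemma get_close b t b' t' r i : close M r (b :: t) (b' :: t') ->
  dist M (get b t i) (get b' t' i) < r.
Proof.
  intros H; apply close_nth; [exact H|]. now inversion H.
Qed.

Lemma dist_perturb x y x' y' r :
  dist M x x' < r -> dist M y y' < r -> Rabs (dist M x' y' - dist M x y) < 2 * r.
Proof.
  intros Hx Hy; apply Rabs_def1.
  - pose proof (tame_tri M T x' x y'); pose proof (tame_tri M T x y y').
    rewrite (tame_sym M T x' x) in H; lra.
  - pose proof (tame_tri M T x x' y); pose proof (tame_tri M T x' y' y).
    rewrite (tame_sym M T y' y) in H0; lra.
Qed.

Lemma near_perturb x x' a b c s :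
  0 < s -> Rabs (x - (INR a - INR b) * pw c) + s <= pw c -> Rabs (x' - x) < s ->
  near x' a b c.
Proof.
  intros Hs H H'; unfold near.
  replace (x' - (INR a - INR b) * pw c) with ((x' - x) + (x - (INR a - INR b) * pw c)) by ring.
  eapply Rle_lt_trans; [apply Rabs_triang|]; lra.
Qed.

(** Slack [pw h] is twice [pw (S h)]: one half pays for the perturbation, the other remains as
    slack. The class [p] may be replaced by an equivalent [p'] because moving the tail changes the
    representative of the parent piece. *)
Lemma cond_open l p b t : cond M l p b t -> exists r, 0 < r /\
  forall b' t' p', close M r (b :: t) (b' :: t') -> (forall v, p' v <-> p v) ->
    cond M l p' b' t'.
Proof.
  destruct l as [|i j a a' c|q v a a' c|r|j D e|n d k]; simpl.
  - exists 1; split; [lra|easy].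
  - intros H; unfold near in H.
    set (s := pw c - Rabs (dist M (get b t i) (get b t j) - (INR a - INR a') * pw c)) in *.
    assert (Hs : 0 < s) by (unfold s; lra).
    exists (s / 2); split; [lra|]; intros b' t' p' Hc _.
    apply near_perturb with (dist M (get b t i) (get b t j)) s; [easy|unfold s; lra|].
    replace s with (2 * (s / 2)) by lra.
    apply dist_perturb; now apply get_close.
  - destruct (classic (exists P, pred_code L P = q)) as [[P HP]|HP].
    2:{ intros _; exists 1; split; [lra|]; intros; exfalso; eauto. }
    intros H; specialize (H P HP); unfold near in H.
    set (x := fun k => get b t (nth (proj1_sig (Fin.to_nat k)) v 0%nat)) in *.
    set (s := pw c - Rabs (interp M P x - (INR a - INR a') * pw c)) in *.
    assert (Hs : 0 < s) by (unfold s; lra).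
    exists (modulus L P (s / 2)); split; [apply modulus_pos; lra|].
    intros b' t' p' Hc _ P' HP'.
    assert (P' = P) as -> by (apply (pred_code_inj L); congruence).
    apply near_perturb with (interp M P x) s; [easy|unfold s; lra|].
    apply Rle_lt_trans with (s / 2); [|lra].
    rewrite Rabs_minus_sym; apply (tame_cont M T); [lra|].
    intros k; now apply get_close.
  - intros [h Hh]; exists (pw (S h)); split; [apply pw_pos|].
    intros b' t' p' Hc _; exists (S h); intros e.
    destruct (Hh e) as [F HF]; exists F; intros z Hz; apply HF.
    inversion Hc; subst.
    pose proof (tame_tri M T b b' z); rewrite pw_S in *; lra.
  - intros [h Hh]; exists (pw (S h)); split; [apply pw_pos|].
    intros b' t' p' Hc _; exists (S h); intros z Hz.
    destruct (Hh z) as [y [Hy Hyz]].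
    { pose proof (get_close _ _ _ _ _ j Hc).
      pose proof (tame_tri M T (get b t j) (get b' t' j) z); rewrite pw_S in *; lra. }
    assert (Hy' : exists y', In y' (b' :: t') /\ dist M y y' < pw (S h)).
    { clear - Hc Hy. induction Hc as [|u u' x x' Hu Hx IH]; [easy|].
      destruct Hy as [<-|Hy]; [exists u'; simpl; auto|].
      destruct (IH Hy) as [y' [H1 H2]]; exists y'; simpl; auto. }
    destruct Hy' as [y' [H1 H2]]; exists y'; split; [easy|].
    pose proof (tame_tri M T y' y z); rewrite (tame_sym M T y' y) in H.
    rewrite pw_S in *; lra.
  - intros [h Hh]; exists (pw (S h)); split; [apply pw_pos|].
    intros b' t' p' Hc Hp; exists (S h); intros ws Hws HF HO.
    apply (Hh ws Hws).
    + apply Forall_impl with (2 := HF); intros v [[Hv [e He]] Hvc].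
      split; [split; [easy|exists e; now apply Hp]|].
      apply close_mono with (2 * pw d + pw (S h) + pw (S h)); [rewrite pw_S; lra|].
      apply close_trans with (lastn n t'); [easy|easy|].
      apply close_lastn; apply close_sym; [easy|]. now inversion Hc.
    + clear - HO. induction HO as [|v vs Hv Hvs IH]; constructor; [|easy].
      apply Forall_impl with (2 := Hv); intros v' Hn Hcl; apply Hn.
      apply close_mono with (2 := Hcl); pose proof (pw_S h); pose proof (pw_pos h); lra.
Qed.

Lemma piece_open lam x : piece M lam x x ->
  exists r, 0 < r /\ forall y, close M r x y -> piece M lam x y.
Proof.
  revert x; induction lam as [|l lam IH]; intros x Hx.
  - exists 1; split; [lra|]; intros y Hy; destruct Hx as [-> _].
    inversion Hy; now split.
  - assert (Ha : adm M l (piece M lam) x) by apply Hx.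
    destruct x as [|b t]; [easy|]; destruct Ha as [Ht Hc].
    destruct (IH t Ht) as [r1 [Hr1 H1]].
    destruct (cond_open _ _ _ _ Hc) as [r2 [Hr2 H2]].
    set (r := Rmin (Rmin r1 r2) (pw (length lam))).
    assert (0 < r) by (unfold r; repeat apply Rmin_pos; auto; apply pw_pos).
    assert (r <= r1 /\ r <= r2 /\ r <= pw (length lam)) as (E1 & E2 & E3).
    { unfold r; pose proof (Rmin_l (Rmin r1 r2) (pw (length lam)));
      pose proof (Rmin_r (Rmin r1 r2) (pw (length lam)));
      pose proof (Rmin_l r1 r2); pose proof (Rmin_r r1 r2); lra. }
    exists r; split; [easy|]; intros y Hy.
    split; [now split|]; exists 1%nat; exists (b :: t); split; [easy|].
    inversion Hy as [|? b' ? t' Hb Htt]; subst.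
    assert (Hp : piece M lam t t') by (apply H1; now apply close_mono with r).
    split; [now split|]; split; [|split; [exact Hp|now apply close_mono with r]].
    split; [now apply piece_refl_r with t|].
    apply H2; [now apply close_mono with r|].
    intros v; symmetry; now apply piece_class.
Qed.

Lemma piece_open_class lam x y : piece M lam x y ->
  exists r, 0 < r /\ forall z, close M r y z -> piece M lam x z.
Proof.
  intros H; destruct (piece_open lam y) as [r [Hr Hz]]; [now apply piece_refl_r with x|].
  exists r; split; [easy|]; intros z Hc; apply piece_trans with y; auto.
Qed.
End Tame.

(** * Pieces computed in a dense subset *)

Section Transfer.
Context (A M : structure L) (f : A -> M) (D : dense_map A M f).

Let TM : tame M := dm_tame A M f D.

Lemma map_get b t i : f (get b t i) = get (f b) (map f t) i.
Proof.
  unfold get; change (f b :: map f t) with (map f (b :: t)).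
  rewrite <- map_rev; symmetry; apply map_nth.
Qed.

(** Towards [M], a point of the ball is first moved to a dense point, which costs half of the slack
    in the radius; towards [A], only the net points move, which costs half of the precision
    [pw e]. *)
Lemma tball_transfer b r : (exists h, tball A b (r + pw h)) <-> (exists h, tball M (f b) (r + pw h)).
Proof.
  split; intros [h Hh].
  - exists (S h); intros e; destruct (Hh (S e)) as [F HF].
    exists (map f F); intros z Hz.
    destruct (dm_dense A M f D z (Rmin (pw (S h)) (pw (S e)))) as [s Hs].
    { apply Rmin_pos; apply pw_pos. }
    pose proof (Rmin_l (pw (S h)) (pw (S e))); pose proof (Rmin_r (pw (S h)) (pw (S e))).
    destruct (HF s) as [y [Hy Hys]].
    { rewrite <- (dm_dist A M f D).
      pose proof (tame_tri M TM (f b) z (f s)); rewrite (pw_S h) in *; lra. }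
    exists (f y); split; [now apply in_map|].
    rewrite <- (dm_dist A M f D) in Hys.
    pose proof (tame_tri M TM (f y) (f s) z); rewrite (tame_sym M TM (f s) z) in H1.
    rewrite (pw_S e) in *; lra.
  - exists h; intros e; destruct (Hh (S e)) as [F HF].
    assert (HG : exists G, forall y, In y F -> exists g, In g G /\ dist M y (f g) < pw (S e)).
    { clear HF. induction F as [|y F [G HG]]; [exists nil; easy|].
      destruct (dm_dense A M f D y (pw (S e)) (pw_pos _)) as [g Hg].
      exists (g :: G); intros y' [<-|Hy']; [exists g; simpl; auto|].
      destruct (HG y' Hy') as [g' [H1 H2]]; exists g'; simpl; auto. }
    destruct HG as [G HG]; exists G; intros z Hz.
    destruct (HF (f z)) as [y [Hy Hyz]]; [now rewrite (dm_dist A M f D)|].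
    destruct (HG y Hy) as [g [Hg Hgy]]; exists g; split; [easy|].
    rewrite <- (dm_dist A M f D).
    pose proof (tame_tri M TM (f g) y (f z)); rewrite (tame_sym M TM (f g) y) in H.
    rewrite (pw_S e) in *; lra.
Qed.

Lemma netted_transfer b D' e u :
  (exists h, netted A b (D' + pw h) u (e - pw h)) <->
  (exists h, netted M (f b) (D' + pw h) (map f u) (e - pw h)).
Proof.
  split; intros [h Hh].
  - exists (S h); intros z Hz.
    destruct (dm_dense A M f D z (pw (S h)) (pw_pos _)) as [s Hs].
    destruct (Hh s) as [y [Hy Hys]].
    { rewrite <- (dm_dist A M f D).
      pose proof (tame_tri M TM (f b) z (f s)); rewrite (pw_S h) in *; lra. }
    exists (f y); split; [now apply in_map|].
    rewrite <- (dm_dist A M f D) in Hys.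
    pose proof (tame_tri M TM (f y) (f s) z); rewrite (tame_sym M TM (f s) z) in H.
    rewrite (pw_S h) in *; lra.
  - exists h; intros z Hz; destruct (Hh (f z)) as [y [Hy Hyz]].
    { now rewrite (dm_dist A M f D). }
    apply in_map_iff in Hy; destruct Hy as [y' [<- Hy']].
    exists y'; split; [easy|]; now rewrite <- (dm_dist A M f D).
Qed.

Lemma packed_transfer pA pM n d k w :
  (forall v, pA v <-> pM (map f v)) ->
  (forall v, pM v -> exists r, 0 < r /\ forall v', close M r v v' -> pM v') ->
  (exists h, packed A pA n (2 * pw d + pw h) (pw d - pw h) k w) <->
  (exists h, packed M pM n (2 * pw d + pw h) (pw d - pw h) k (map f w)).
Proof.
  intros Hp Ho; split; intros [h Hh].
  - exists (S h); intros ws Hws HF HO.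
    (* Two errors of [pw (S (S h))] add up to [pw (S h)], the difference between the slacks [pw h]
       and [pw (S h)]. Openness of [pM] keeps the approximating tuples, with their completions, in
       the piece. *)
    assert (HA : exists vs, Forall2 (fun w' v => close M (pw (S (S h))) w' (map f v) /\
        proj pA n v) ws vs).
    { clear Hws HO. induction HF as [|w' ws [[Hl [e He]] Hc] HF [vs IH]]; [exists nil; easy|].
      destruct (Ho _ He) as [r [Hr Hopen]].
      destruct (dense_list A M f D e (Rmin r (pw (S (S h))))) as [e' He'];
        [apply Rmin_pos; [easy|apply pw_pos]|].
      destruct (dense_list A M f D w' (Rmin r (pw (S (S h))))) as [v Hv];
        [apply Rmin_pos; [easy|apply pw_pos]|].
      pose proof (Rmin_l r (pw (S (S h)))); pose proof (Rmin_r r (pw (S (S h)))).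
      exists (v :: vs); constructor; [|easy]; split; [now apply close_mono with (2 := Hv)|].
      split; [apply close_length in Hv; rewrite length_map in Hv; congruence|].
      exists e'; apply Hp; rewrite map_app; apply Hopen.
      apply close_mono with (Rmin r (pw (S (S h)))); [easy|]; now apply close_app. }
    destruct HA as [vs Hvs].
    pose proof (pw_S h); pose proof (pw_S (S h)); pose proof (pw_pos (S (S h))).
    apply (Hh vs).
    + apply Forall2_length in Hvs; congruence.
    + clear Hws HO. induction Hvs as [|w' v ws vs [Hc Hv] Hvs IH]; constructor.
      * split; [easy|]. apply (close_map A M f D).
        apply close_mono with (pw (S (S h)) + (2 * pw d + pw (S h))); [lra|].
        apply close_trans with w'; [easy|now apply close_sym|].
        inversion HF; now subst.
      * inversion HF; auto.
    + clear Hws HF. induction Hvs as [|w' v ws vs [Hc Hv] Hvs IH]; constructor.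
      * inversion HO as [|? ? H2 H3]; subst. clear - Hc Hvs H2 H H0 D TM.
        induction Hvs as [|w'' v'' ws vs [Hc' _] Hvs IH]; constructor.
        -- inversion H2 as [|? ? H3 H4]; subst; intros Hcl; apply H3.
           apply close_mono with (pw (S (S h)) + (pw d - pw h) + pw (S (S h))); [lra|].
           apply close_trans with (map f v''); [apply TM| |now apply close_sym; [apply TM|]].
           apply close_trans with (map f v); [apply TM|easy|now apply (close_map A M f D)].
        -- apply IH; now inversion H2.
      * apply IH; now inversion HO.
  - exists h; intros ws Hws HF HO; apply (Hh (map (map f) ws)).
    + now rewrite length_map.
    + clear Hws HO; induction HF as [|v ws [[Hl [e He]] Hc] HF IH]; simpl; constructor; [|easy].
      split; [split; [now rewrite length_map|]|now apply (close_map A M f D)].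
      exists (map f e); rewrite <- map_app; now apply Hp.
    + clear Hws HF; induction HO as [|v ws Hv HO IH]; simpl; constructor; [|easy].
      apply Forall_map; apply Forall_impl with (2 := Hv); intros v' Hn Hc; apply Hn.
      now apply (close_map A M f D).
Qed.

Lemma cond_transfer l pA pM b t :
  (forall v, pA v <-> pM (map f v)) ->
  (forall v, pM v -> exists r, 0 < r /\ forall v', close M r v v' -> pM v') ->
  cond A l pA b t <-> cond M l pM (f b) (map f t).
Proof.
  intros Hp Ho; destruct l as [|i j a a' c|q v a a' c|r|j D' e|n d k]; simpl.
  - easy.
  - now rewrite <- !map_get, (dm_dist A M f D).
  - split; intros H P HP; specialize (H P HP); unfold near in *;
      rewrite <- (dm_interp A M f D) in *;
      replace (fun k : Fin.t (arity L P) => f (get b t (nth (proj1_sig (Fin.to_nat k)) v 0%nat)))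
        with (fun k : Fin.t (arity L P) =>
          get (f b) (map f t) (nth (proj1_sig (Fin.to_nat k)) v 0%nat)) in *; try easy;
      extensionality k; now rewrite map_get.
  - apply tball_transfer.
  - rewrite <- map_get; change (f b :: map f t) with (map f (b :: t)).
    now apply netted_transfer.
  - rewrite lastn_map; now apply packed_transfer.
Qed.

(** The nontrivial direction replaces a chain of arbitrary tuples of [M] by one of dense tuples;
    this works because pieces are open and the closeness required in a step is strict. *)
Lemma piece_transfer lam x y : piece A lam x y <-> piece M lam (map f x) (map f y).
Proof.
  revert x y; induction lam as [|l lam IH]; intros x y.
  - simpl; split; intros [H1 H2]; [now subst|].
    split; [now destruct x|now destruct y].
  - assert (Hadm : forall u, adm A l (piece A lam) u <-> adm M l (piece M lam) (map f u)).
    { intros [|b t]; [easy|]; simpl. rewrite IH.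
      rewrite (cond_transfer l (piece A lam t) (piece M lam (map f t)) b t); [easy| |].
      - intros v; apply IH.
      - intros v Hv; now apply piece_open_class. }
    assert (Hstep : forall r u v, step A l (piece A lam) r u v <->
        step M l (piece M lam) r (map f u) (map f v)).
    { intros r u v; unfold step; rewrite !Hadm, IH, (close_map A M f D).
      destruct u, v; simpl; easy. }
    split; intros [Hx [n Hn]].
    + split; [now apply Hadm|]; exists n.
      revert y Hn; induction n as [|n IHn]; simpl; intros y Hn; [now subst|].
      destruct Hn as [u [Hu Hs]]; exists (map f u); split; [now apply IHn|now apply Hstep].
    + assert (HX : adm A l (piece A lam) x) by now apply Hadm.
      assert (Hpt : forall m u, reach (step M l (piece M lam) (pw (length lam))) m (map f x) u ->
        piece M (l :: lam) (map f x) u) by (intros m u Hu; split; eauto).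
      (* Strengthened for induction: tuples of [M] on the chain need not come from [A], but all
         dense tuples close to them are reached inside [A]. *)
      assert (Hkey : forall m v,
        reach (step M l (piece M lam) (pw (length lam))) m (map f x) v ->
        exists r, 0 < r /\ forall z, close M r v (map f z) -> piece A (l :: lam) x z).
      { intros m; induction m as [|m IHm]; intros v Hv; pose proof (Hpt _ _ Hv) as Hv'.
        - simpl in Hv; subst v.
          destruct (piece_open M TM (l :: lam) (map f x)) as [r [Hr Hro]]; [easy|].
          exists (Rmin r (pw (length lam))).
          pose proof (Rmin_l r (pw (length lam))); pose proof (Rmin_r r (pw (length lam))).
          split; [apply Rmin_pos; [easy|apply pw_pos]|].
          intros z Hz; assert (Hzp : piece M (l :: lam) (map f x) (map f z)).
          { apply Hro; now apply close_mono with (2 := Hz). }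
          split; [easy|]; exists 1%nat, x; split; [easy|]; apply Hstep.
          split; [now apply Hadm|]; split; [now apply piece_adm_r with (map f x)|].
          split; [now apply piece_tl with l|]. now apply close_mono with (2 := Hz).
        - destruct Hv as [u [Hu Hs]]; pose proof (Hpt _ _ Hu) as Hu'.
          destruct (IHm u Hu) as [r1 [Hr1 H1]].
          destruct (piece_open_class M TM _ _ _ Hu') as [r2 [Hr2 H2]].
          destruct (piece_open_class M TM _ _ _ Hv') as [r3 [Hr3 H3]].
          destruct Hs as (_ & _ & _ & Hs).
          destruct (close_slack M _ _ _ Hs) as [s [Hs0 Hss]].
          (* The slack [s] of the step is shared by its two end points, each being moved by at most
             [s / 2]. *)
          set (ru := Rmin (Rmin r1 r2) (s / 2)); set (rv := Rmin r3 (s / 2)).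
          assert (0 < ru) by (unfold ru; repeat apply Rmin_pos; lra).
          assert (ru <= r1 /\ ru <= r2 /\ ru <= s / 2) as (E1 & E2 & E3).
          { unfold ru; pose proof (Rmin_l (Rmin r1 r2) (s / 2));
            pose proof (Rmin_r (Rmin r1 r2) (s / 2));
            pose proof (Rmin_l r1 r2); pose proof (Rmin_r r1 r2); lra. }
          pose proof (Rmin_l r3 (s / 2)) as F1; pose proof (Rmin_r r3 (s / 2)) as F2.
          fold rv in F1, F2.
          destruct (dense_list A M f D u ru) as [zu Hzu]; [easy|].
          assert (HA : piece A (l :: lam) x zu) by (apply H1; now apply close_mono with ru).
          assert (HM : piece M (l :: lam) (map f x) (map f zu))
            by (apply H2; now apply close_mono with ru).
          exists rv; split; [unfold rv; apply Rmin_pos; lra|]; intros z Hz.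
          assert (HZ : piece M (l :: lam) (map f x) (map f z))
            by (apply H3; now apply close_mono with rv).
          destruct HA as [_ [k Hk]]; split; [easy|]; exists (S k), zu; split; [easy|].
          apply Hstep; split; [now apply piece_adm_r with (map f x)|].
          split; [now apply piece_adm_r with (map f x)|]; split.
          + apply (piece_tl M l). apply piece_trans with (map f x); [now apply piece_sym|easy].
          + apply close_mono with (ru + (pw (length lam) - s) + rv); [lra|].
            apply close_trans with v; [apply TM| |easy].
            apply close_trans with u; [apply TM|now apply close_sym|easy]. }
      destruct (Hkey _ _ Hn) as [r [Hr Hro]]; apply Hro; apply close_refl; [apply TM|easy].
Qed.
End Transfer.
End Pieces.

(** * The Borel map to countable structures *)

Definition countable (A : Type) : Prop :=
  exists f : A -> nat, forall x y, f x = f y -> x = y.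

Lemma countable_nat : countable nat.
Proof. exists (fun n => n); auto. Qed.

Lemma countable_inj {A B : Type} (f : A -> B) :
  (forall x y, f x = f y -> x = y) -> countable B -> countable A.
Proof. intros Hf [g Hg]; exists (fun x => g (f x)); auto. Qed.

Lemma countable_prod {A B} : countable A -> countable B -> countable (A * B).
Proof.
  intros [f Hf] [g Hg]; exists (fun p => to_nat (f (fst p), g (snd p))).
  intros [a b] [a' b'] H; apply to_nat_inj in H; injection H as H1 H2.
  f_equal; auto.
Qed.

Lemma countable_list {A} : countable A -> countable (list A).
Proof.
  intros [f Hf].
  exists (fix code l := match l with [] => 0%nat | a :: l => S (to_nat (f a, code l)) end).
  induction x as [|a x IH]; intros [|b y] H; try discriminate; [easy|].
  apply eq_add_S, to_nat_inj in H; injection H as H1 H2.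
  f_equal; auto.
Qed.

(** The first component of the Cantor pair selects the element; the second is free, which yields
    arbitrarily large indices for it. *)
Lemma countable_enum {A} (a0 : A) : countable A ->
  exists e : nat -> A, forall a N, exists t, (N <= t)%nat /\ e t = a.
Proof.
  intros [f Hf].
  exists (fun m => epsilon (inhabits a0) (fun t => f t = fst (of_nat m))).
  intros a N; exists (to_nat (f a, N)); split.
  - pose proof (to_nat_non_decreasing (f a) N); lia.
  - rewrite cancel_of_to; simpl; apply Hf.
    apply (epsilon_spec (inhabits a0) (fun t' => f t' = f a)); now exists a.
Qed.

Lemma countable_label : countable label.
Proof.
  apply (@countable_inj _ (nat * list nat * list nat) (fun l => match l with
    | Lfree => (0, [], [])
    | Ldist i j a b c => (1, [i; j; a; b; c], [])
    | Lpred q v a b c => (2, [q; a; b; c], v)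
    | Ltb r => (3, [r], [])
    | Lnet j D e => (4, [j; D; e], [])
    | Lstab n d k => (5, [n; d; k], [])
    end)%nat).
  - intros [] [] H; try discriminate H; try injection H; intros; subst; easy.
  - auto using countable_prod, countable_list, countable_nat.
Qed.

Section Borel.
Context {L : signature}.

Definition bor (A : Code L -> Prop) : Prop := code_borel A.

Lemma bor_ext A B : (forall c, A c <-> B c) -> bor A -> bor B.
Proof. intros H HA; now apply sg_ext with A. Qed.

Lemma bor_not A : bor A -> bor (fun c => ~ A c).
Proof. apply sg_compl. Qed.

Lemma bor_const (P : Prop) : bor (fun _ => P).
Proof.
  assert (HF : bor (fun _ => False)).
  (* The empty set is not among the generators; it is the complement of the union of a generator
     with its own complement. *)
  { apply bor_ext with (fun c => ~ (exists n : nat,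
      (fun (n : nat) c => match n with O => fst c O O < 0 | _ => ~ fst c O O < 0 end) n c)).
    - intros c; split; [|easy]; intros H; apply H.
      destruct (classic (fst c O O < 0)); [exists O|exists 1%nat]; easy.
    - apply sg_compl, sg_union; intros [|n]; [|apply sg_compl];
        apply sg_gen; left; exists O, O, 0; easy. }
  destruct (classic P).
  - apply bor_ext with (fun _ => ~ False); [tauto|now apply bor_not].
  - apply bor_ext with (fun _ => False); [tauto|easy].
Qed.

Lemma bor_ex {A} (P : A -> Code L -> Prop) : countable A ->
  (forall a, bor (P a)) -> bor (fun c => exists a, P a c).
Proof.
  intros [f Hf] HP.
  apply bor_ext with (fun c => exists n, (fun n c => exists a, f a = n /\ P a c) n c).
  - intros c; split; [intros [n [a [_ H]]]; now exists a|intros [a H]; now exists (f a), a].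
  - apply sg_union; intros n.
    destruct (classic (exists a, f a = n)) as [[a Ha]|Hn].
    + apply bor_ext with (P a); [|easy]. intros c; split; [intros H; now exists a|].
      intros [a' [Ha' H]]; assert (a' = a) as -> by (apply Hf; congruence); easy.
    + apply bor_ext with (fun _ => False); [|apply bor_const].
      intros c; split; [easy|]; intros [a [Ha _]]; apply Hn; now exists a.
Qed.

Lemma bor_all {A} (P : A -> Code L -> Prop) : countable A ->
  (forall a, bor (P a)) -> bor (fun c => forall a, P a c).
Proof.
  intros HA HP; apply bor_ext with (fun c => ~ exists a, ~ P a c).
  - intros c; split; [intros H a; apply NNPP; intros Hn; apply H; now exists a|].
    intros H [a Ha]; now apply Ha.
  - apply bor_not, bor_ex; [easy|]; intros a; now apply bor_not.
Qed.

Lemma bor_and A B : bor A -> bor B -> bor (fun c => A c /\ B c).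
Proof.
  intros HA HB; apply bor_ext with (fun c => forall n : nat, match n with O => A c | _ => B c end).
  - intros c; split; [intros H; split; [apply (H O)|apply (H 1%nat)]|intros H [|n]; apply H].
  - apply (bor_all (fun (n : nat) c => match n with O => A c | _ => B c end));
      [apply countable_nat|]; intros [|n]; easy.
Qed.

Lemma bor_imp A B : bor A -> bor B -> bor (fun c => A c -> B c).
Proof.
  intros HA HB; apply bor_ext with (fun c => ~ (A c /\ ~ B c)).
  - intros c; split; [intros H HA'; apply NNPP; tauto|tauto].
  - auto using bor_and, bor_not.
Qed.

Lemma bor_Forall {A} (P : A -> Code L -> Prop) l :
  (forall a, bor (P a)) -> bor (fun c => Forall (fun a => P a c) l).
Proof.
  intros HP; induction l as [|a l IH].
  - apply bor_ext with (fun _ => True); [|apply bor_const]. intros c; split; auto.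
  - apply bor_ext with (fun c => P a c /\ Forall (fun a => P a c) l); [|now apply bor_and].
    intros c; symmetry; apply Forall_cons_iff.
Qed.

Lemma bor_FOP {A} (P : A -> A -> Code L -> Prop) l :
  (forall a b, bor (P a b)) -> bor (fun c => ForallOrdPairs (fun a b => P a b c) l).
Proof.
  intros HP; induction l as [|a l IH].
  - apply bor_ext with (fun _ => True); [|apply bor_const]. intros c; split; constructor.
  - apply bor_ext with (fun c => Forall (fun b => P a b c) l /\
      ForallOrdPairs (fun a b => P a b c) l); [|apply bor_and; [now apply bor_Forall|easy]].
    intros c; split; [intros []; now constructor|intros H; inversion H; now split].
Qed.

Definition bormeas (g : Code L -> R) : Prop := forall r, bor (fun c => g c < r).

(** Generators only bound from above; the strict lower bound is a countable union of complements. *)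
Lemma bormeas_near g a b e : bormeas g -> bor (fun c => near (g c) a b e).
Proof.
  intros Hg; set (q := (INR a - INR b) * pw e).
  apply bor_ext with (fun c => g c < q + pw e /\ exists n, ~ (g c < q - pw e + pw n)).
  - intros c; unfold near; fold q; split.
    + intros [H1 [n Hn]]; pose proof (pw_pos n); apply Rabs_def1; lra.
    + intros H; apply Rabs_def2 in H; split; [lra|].
      destruct (pw_small (g c - (q - pw e))) as [n Hn]; [lra|]; exists n; lra.
  - apply bor_and; [apply Hg|]. apply bor_ex; [apply countable_nat|].
    intros n; apply bor_not, Hg.
Qed.

Definition cst (c : Code L) : structure L :=
  {| carrier := nat; dist := fst c; interp := snd c |}.

Lemma bor_dist (i j : nat) r : bor (fun c => fst c i j < r).
Proof. apply sg_gen; left; exists i, j, r; easy. Qed.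

Lemma bormeas_dist (i j : nat) : bormeas (fun c => dist (cst c) i j).
Proof. intros r; apply bor_dist. Qed.

Lemma bormeas_interp P (v : Fin.t (arity L P) -> nat) : bormeas (fun c => interp (cst c) P v).
Proof. intros r; apply sg_gen; right; exists P, v, r; easy. Qed.

Lemma bor_close r (x y : list nat) : bor (fun c => close (cst c) r x y).
Proof.
  revert y; induction x as [|a x IH]; intros [|b y].
  - apply bor_ext with (fun _ => True); [|apply bor_const]. split; constructor.
  - apply bor_ext with (fun _ => False); [|apply bor_const].
    split; [easy|intros H; inversion H].
  - apply bor_ext with (fun _ => False); [|apply bor_const].
    split; [easy|intros H; inversion H].
  - apply bor_ext with (fun c => dist (cst c) a b < r /\ close (cst c) r x y).
    + intros c; split; [intros []; now constructor|intros H; now inversion H].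
    + apply bor_and; [apply bormeas_dist|apply IH].
Qed.

Lemma countable_Pred : countable (Pred L).
Proof. exists (pred_code L); apply pred_code_inj. Qed.

Hint Resolve countable_nat countable_list countable_Pred bor_const bormeas_dist
  bormeas_interp bor_close bormeas_near : bor.

Ltac bor := repeat first
  [ apply bor_ex; [solve [auto with bor]|intros ?]
  | apply bor_all; [solve [auto with bor]|intros ?]
  | apply bor_and | apply bor_not | apply bor_imp
  | apply bor_dist | solve [auto with bor] ].

Lemma bor_cond l (p : Code L -> list nat -> Prop) (b : nat) (t : list nat) :
  (forall v, bor (fun c => p c v)) -> bor (fun c => cond (cst c) l (p c) b t).
Proof.
  intros Hp; destruct l as [|i j a a' e|q v a a' e|r|j D e|n d k]; simpl.
  - apply bor_const.
  - apply (bormeas_near (fun c => dist (cst c) (get b t i) (get b t j))); auto with bor.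
  - apply bor_all; [auto with bor|]; intros P; apply bor_imp; [auto with bor|].
    apply (bormeas_near (fun c => interp (cst c) P (fun k => get b t _))); auto with bor.
  - unfold tball; cbn [cst carrier dist]; bor.
  - unfold netted; cbn [cst carrier dist]; bor.
  - apply bor_ex; [auto with bor|]; intros h; unfold packed; cbn [cst carrier].
    apply bor_all; [auto using countable_list, countable_nat|]; intros ws.
    apply bor_imp; [auto with bor|]; apply bor_imp.
    + apply (bor_Forall (fun (v : list nat) c => proj (p c) n v /\
        close (cst c) (2 * pw d + pw h) v (lastn n t))).
      intros v; apply bor_and; [|auto with bor].
      unfold proj; apply bor_and; [auto with bor|]. apply bor_ex; auto with bor.
    + apply bor_not. apply (bor_FOP (fun (v v' : list nat) c => ~ close (cst c) (pw d - pw h) v v')).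
      intros v v'; auto using bor_not with bor.
Qed.

Lemma bor_piece lam (x y : list nat) : bor (fun c => piece (cst c) lam x y).
Proof.
  revert x y; induction lam as [|l lam IH]; intros x y; simpl; [bor|].
  assert (Ha : forall u : list nat, bor (fun c => adm (cst c) l (piece (cst c) lam) u)).
  { intros [|b t]; simpl; [bor|]. apply bor_and; [apply IH|].
    apply (bor_cond l (fun c => piece (cst c) lam t)); intros v; apply IH. }
  apply bor_and; [apply Ha|]. apply bor_ex; [auto with bor|]; intros n.
  revert y; induction n as [|n IHn]; intros y; simpl; [bor|].
  cbn [cst carrier]; apply bor_ex; [auto with bor|]; intros u; apply bor_and; [apply IHn|].
  unfold step; repeat apply bor_and;
    first [apply Ha|apply (IH (tl u) (tl y))|apply bor_close].
Qed.

Lemma countable_names : countable (list label * list nat).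
Proof. auto using countable_prod, countable_list, countable_nat, countable_label. Qed.

(* Every pair has infinitely many names, so that any correspondence between the valid names of two
   codes contains a bijection. *)
Definition name : nat -> list label * list nat :=
  proj1_sig (constructive_indefinite_description _ (countable_enum ([], []) countable_names)).

Lemma name_surj t N : exists m, (N <= m)%nat /\ name m = t.
Proof.
  apply (proj2_sig (constructive_indefinite_description _
    (countable_enum ([], []) countable_names))).
Qed.

Lemma countable_syms : countable (option (list label)).
Proof.
  destruct (countable_list countable_label) as [f Hf].
  exists (fun s => match s with None => O | Some lam => S (f lam) end).
  intros [x|] [y|] H; try discriminate; [|easy].
  f_equal; apply Hf; now apply eq_add_S.
Qed.

(** One unary symbol for each list of labels and a binary symbol for the child relation. Both depend
    only on the piece that a name denotes, so distinct names of one piece are interchangeable and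
    need not be identified. *)
Definition sym_lang : rel_language := {|
  Sym := option (list label);
  sym_code := proj1_sig (constructive_indefinite_description _ countable_syms);
  sym_code_inj := proj2_sig (constructive_indefinite_description _ countable_syms);
  sarity := fun s => match s with Some _ => 1%nat | None => 2%nat end |}.

Definition valid (c : Code L) (m : nat) : Prop :=
  piece (cst c) (fst (name m)) (snd (name m)) (snd (name m)).

Definition labelled (c : Code L) (lam : list label) (m : nat) : Prop :=
  fst (name m) = lam /\ valid c m.

Definition child (c : Code L) (m m' : nat) : Prop :=
  valid c m /\ valid c m' /\ tl (fst (name m')) = fst (name m) /\ fst (name m') <> [] /\
  piece (cst c) (fst (name m)) (snd (name m)) (tl (snd (name m'))).

Definition holds (c : Code L) (s : Sym sym_lang) : (Fin.t (sarity sym_lang s) -> nat) -> Prop :=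
  match s with
  | Some lam => fun v => labelled c lam (v Fin.F1)
  | None => fun v => child c (v Fin.F1) (v (Fin.FS Fin.F1))
  end.

Definition classify (c : Code L) : cstructure sym_lang :=
  fun s v => if excluded_middle_informative (holds c s v) then true else false.

Lemma classify_true c s v : classify c s v = true <-> holds c s v.
Proof. unfold classify; destruct excluded_middle_informative; easy. Qed.

Lemma bor_holds s v : bor (fun c => holds c s v).
Proof.
  destruct s as [lam|]; simpl in *; unfold labelled, child, valid;
    repeat apply bor_and; first [apply bor_const|apply bor_piece].
Qed.

Lemma classify_borel (B : cstructure sym_lang -> Prop) :
  cstructure_borel B -> code_borel (fun c : Code L => B (classify c)).
Proof.
  induction 1 as [A [s [v HA]]|A HA IH|A HA IH|A B HA IH HAB].
  - apply bor_ext with (fun c => holds c s v); [|apply bor_holds].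
    intros c; rewrite HA; symmetry; apply classify_true.
  - now apply sg_compl.
  - now apply sg_union.
  - apply bor_ext with (fun c => A (classify c)); [intros c; apply HAB|easy].
Qed.
End Borel.

(* Back and forth: greedily match the least unmatched number on either side with a fresh partner. *)
Lemma bijection_within (R : nat -> nat -> Prop) :
  (forall n N, exists m, (N <= m)%nat /\ R n m) ->
  (forall m N, exists n, (N <= n)%nat /\ R n m) ->
  exists p q : nat -> nat, (forall n, q (p n) = n) /\ (forall m, p (q m) = m) /\
    forall n, R n (p n).
Proof.
  intros H1 H2.
  set (good := fun l : list (nat * nat) =>
    (forall n m, In (n, m) l -> R n m) /\
    (forall n m m', In (n, m) l -> In (n, m') l -> m = m') /\
    (forall n n' m, In (n, m) l -> In (n', m) l -> n = n')).
  assert (Hbound : forall l : list (nat * nat), exists N, forall n m, In (n, m) l ->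
    (n < N)%nat /\ (m < N)%nat).
  { induction l as [|[a b] l [N HN]]; [exists O; easy|].
    exists (N + a + b + 1)%nat; intros n m [E|H]; [injection E; lia|].
    apply HN in H; lia. }
  assert (Hl : forall l k, good l -> exists l', good l' /\ incl l l' /\ exists m, In (k, m) l').
  { intros l k (G1 & G2 & G3).
    destruct (classic (exists m, In (k, m) l)) as [Hk|Hk];
      [exists l; split; [now split|]; split; [apply incl_refl|easy]|].
    destruct (Hbound l) as [N HN]; destruct (H1 k N) as [m [Hm HR]].
    exists ((k, m) :: l); split; [|split; [now apply incl_tl, incl_refl|exists m; now left]].
    repeat split.
    - intros a b [E|H]; [injection E; intros; now subst|now apply G1].
    - intros a b b' [E|H] [E'|H'].
      + congruence.
      + injection E; intros; subst; exfalso; eauto.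
      + injection E'; intros; subst; exfalso; eauto.
      + now apply G2 with a.
    - intros a a' b [E|H] [E'|H'].
      + congruence.
      + injection E; intros; subst. apply HN in H'; lia.
      + injection E'; intros; subst. apply HN in H; lia.
      + now apply G3 with b. }
  assert (Hr : forall l k, good l -> exists l', good l' /\ incl l l' /\ exists n, In (n, k) l').
  { intros l k (G1 & G2 & G3).
    destruct (classic (exists n, In (n, k) l)) as [Hk|Hk];
      [exists l; split; [now split|]; split; [apply incl_refl|easy]|].
    destruct (Hbound l) as [N HN]; destruct (H2 k N) as [m [Hm HR]].
    exists ((m, k) :: l); split; [|split; [now apply incl_tl, incl_refl|exists m; now left]].
    repeat split.
    - intros a b [E|H]; [injection E; intros; now subst|now apply G1].
    - intros a b b' [E|H] [E'|H'].
      + congruence.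
      + injection E; intros; subst. apply HN in H'; lia.
      + injection E'; intros; subst. apply HN in H; lia.
      + now apply G2 with a.
    - intros a a' b [E|H] [E'|H'].
      + congruence.
      + injection E; intros; subst; exfalso; eauto.
      + injection E'; intros; subst; exfalso; eauto.
      + now apply G3 with b. }
  assert (Hs : forall (x : {l | good l}) k, exists y : {l | good l},
    incl (proj1_sig x) (proj1_sig y) /\ (exists m, In (k, m) (proj1_sig y)) /\
    exists n, In (n, k) (proj1_sig y)).
  { intros [l G] k; destruct (Hl l k G) as [l1 [G1 [I1 [m Hm]]]].
    destruct (Hr l1 k G1) as [l2 [G2 [I2 Hn]]].
    exists (exist _ l2 G2); simpl; split; [now apply incl_tran with l1|].
    split; [exists m; now apply I2|easy]. }
  assert (G0 : good []) by (repeat split; easy).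
  set (next := fun x k => proj1_sig (constructive_indefinite_description _ (Hs x k))).
  set (s := fix s k := match k with O => exist good [] G0 | S k => next (s k) k end).
  assert (Hnext : forall k, incl (proj1_sig (s k)) (proj1_sig (s (S k))) /\
    (exists m, In (k, m) (proj1_sig (s (S k)))) /\ exists n, In (n, k) (proj1_sig (s (S k)))).
  { intros k; exact (proj2_sig (constructive_indefinite_description _ (Hs (s k) k))). }
  assert (Hmono : forall k k', (k <= k')%nat -> incl (proj1_sig (s k)) (proj1_sig (s k'))).
  { induction 1; [apply incl_refl|]. eapply incl_tran; [exact IHle|apply Hnext]. }
  set (Q := fun n m => exists k, In (n, m) (proj1_sig (s k))).
  assert (HQ : forall a b a' b', Q a b -> Q a' b' -> exists k,
    In (a, b) (proj1_sig (s k)) /\ In (a', b') (proj1_sig (s k))).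
  { intros a b a' b' [k Hk] [k' Hk']; exists (Nat.max k k').
    split; [apply (Hmono k)|apply (Hmono k')]; auto; lia. }
  assert (HF : forall n, exists m, Q n m).
  { intros n; destruct (proj1 (proj2 (Hnext n))) as [m Hm]; exists m; now exists (S n). }
  assert (HB : forall m, exists n, Q n m).
  { intros m; destruct (proj2 (proj2 (Hnext m))) as [n Hn]; exists n; now exists (S m). }
  assert (U1 : forall n m m', Q n m -> Q n m' -> m = m').
  { intros n m m' A B; destruct (HQ _ _ _ _ A B) as [k [Ak Bk]].
    destruct (proj2_sig (s k)) as (_ & G & _); now apply G with n. }
  assert (U2 : forall n n' m, Q n m -> Q n' m -> n = n').
  { intros n n' m A B; destruct (HQ _ _ _ _ A B) as [k [Ak Bk]].
    destruct (proj2_sig (s k)) as (_ & _ & G); now apply G with m. }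
  exists (fun n => proj1_sig (constructive_indefinite_description _ (HF n))).
  exists (fun m => proj1_sig (constructive_indefinite_description _ (HB m))).
  repeat split.
  - intros n; destruct (constructive_indefinite_description _ (HF n)) as [m Hm]; simpl.
    destruct (constructive_indefinite_description _ (HB m)) as [n' Hn']; simpl; eauto.
  - intros m; destruct (constructive_indefinite_description _ (HB m)) as [n Hn]; simpl.
    destruct (constructive_indefinite_description _ (HF n)) as [m' Hm']; simpl; eauto.
  - intros n; destruct (constructive_indefinite_description _ (HF n)) as [m [k Hk]]; simpl.
    destruct (proj2_sig (s k)) as (G & _); now apply G.
Qed.

(** * Isomorphic structures have isomorphic trees of pieces *)

Section Forward.
Context {L : signature}.

Lemma codes_dense_map (c : Code L) M a : codes c M a -> dense_map (cst c) M a.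
Proof.
  intros (HM & Hd & H1 & H2); pose proof (polish_tame M HM) as T.
  split; [easy|symmetry; apply H1|symmetry; apply H2|].
  intros x e He; destruct (Hd O x e He) as [m [_ Hm]]; exists m.
  now rewrite (tame_sym M T).
Qed.

Lemma dense_map_iso (A M N : structure L) f g : dense_map A M f -> tame N ->
  (forall y : N, exists x : M, g x = y) ->
  (forall x y, dist N (g x) (g y) = dist M x y) ->
  (forall P (a : Fin.t (arity L P) -> M), interp N P (fun k => g (a k)) = interp M P a) ->
  dense_map A N (fun s => g (f s)).
Proof.
  intros [TM H1 H2 H3] TN Hs Hd Hi; split; [easy| | |].
  - intros x y; now rewrite Hd.
  - intros P v; now rewrite (Hi P (fun k => f (v k))).
  - intros y e He; destruct (Hs y) as [x <-]; destruct (H3 x e He) as [s Hse].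
    exists s; now rewrite Hd.
Qed.

Lemma dense_in_piece (A M : structure L) f lam x : dense_map A M f ->
  piece M lam x x -> exists s, piece M lam x (map f s).
Proof.
  intros D Hx; destruct (piece_open M (dm_tame A M f D) lam x Hx) as [r [Hr Ho]].
  destruct (dense_list A M f D x r Hr) as [s Hs]; exists s; auto.
Qed.

(** Both codes are compared inside [M]: names are related when they denote the same piece, and
    invalid names with each other. By density every piece has names in both codes, and the
    repetition of names lets the relation contain a bijection. *)
Lemma classify_invariant (c c' : Code L) (M : structure L) (f f' : nat -> M) :
  dense_map (cst c) M f -> dense_map (cst c') M f' -> ciso (classify c) (classify c').
Proof.
  intros D D'; pose proof (dm_tame _ _ _ D) as T.
  set (R := fun m m' =>
    (fst (name m) = fst (name m') /\
      piece M (fst (name m)) (map f (snd (name m))) (map f' (snd (name m')))) \/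
    (~ valid c m /\ ~ valid c' m')).
  assert (HV : forall m, valid c m <->
    piece M (fst (name m)) (map f (snd (name m))) (map f (snd (name m)))).
  { intros m; apply (piece_transfer (cst c) M f D). }
  assert (HV' : forall m, valid c' m <->
    piece M (fst (name m)) (map f' (snd (name m))) (map f' (snd (name m)))).
  { intros m; apply (piece_transfer (cst c') M f' D'). }
  (* The tuple [[O]] is too long for the empty list of labels, so the infinitely many names of this
     pair are invalid for every code and can be partners of any invalid name. *)
  assert (Hinv : forall N, exists m, (N <= m)%nat /\ ~ valid c m /\ ~ valid c' m).
  { intros N; destruct (name_surj ([], [O]) N) as [m [Hm Hn]]; exists m.
    split; [easy|]; unfold valid; rewrite Hn; simpl; split; intros [? _]; discriminate. }
  destruct (bijection_within R) as (p & q & Hqp & Hpq & HR).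
  - intros m N; destruct (classic (valid c m)) as [Hm|Hm].
    + apply HV in Hm; destruct (dense_in_piece (cst c') M f' _ _ D' Hm) as [s Hs].
      destruct (name_surj (fst (name m), s) N) as [m' [Hm' Hn]].
      exists m'; split; [easy|]; left; rewrite Hn; now split.
    + destruct (Hinv N) as [m' (Hm' & _ & Hn)]; exists m'; split; [easy|]; now right.
  - intros m N; destruct (classic (valid c' m)) as [Hm|Hm].
    + apply HV' in Hm; destruct (dense_in_piece (cst c) M f _ _ D Hm) as [s Hs].
      destruct (name_surj (fst (name m), s) N) as [m' [Hm' Hn]].
      exists m'; split; [easy|]; left; rewrite Hn; split; [easy|]; now apply piece_sym.
    + destruct (Hinv N) as [m' (Hm' & Hn & _)]; exists m'; split; [easy|]; now right.
  - assert (Hval : forall m m', R m m' -> (valid c m <-> valid c' m')).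
    { intros m m' [[E H]|H]; [|tauto]. rewrite HV, HV', <- E; split; intros _.
      - now apply piece_refl_r with (map f (snd (name m))).
      - now apply piece_refl_l with (map f' (snd (name m'))). }
    exists p, q; split; [easy|]; split; [easy|].
    intros s v; apply Bool.eq_iff_eq_true; rewrite !classify_true.
    destruct s as [lam|]; simpl in v |- *.
    + unfold labelled; rewrite <- (Hval _ _ (HR (v Fin.F1))).
      destruct (HR (v Fin.F1)) as [[E _]|[H _]]; [now rewrite E|tauto].
    + unfold child; rewrite <- !(Hval _ _ (HR _)).
      destruct (HR (v Fin.F1)) as [[E1 H1]|[H1 _]]; [|tauto].
      destruct (HR (v (Fin.FS Fin.F1))) as [[E2 H2]|[H2 _]]; [|tauto].
      rewrite <- E1, <- E2.
      assert (HX : tl (fst (name (v (Fin.FS Fin.F1)))) = fst (name (v Fin.F1)) ->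
        fst (name (v (Fin.FS Fin.F1))) <> [] ->
        (piece (cst c') (fst (name (v Fin.F1))) (snd (name (p (v Fin.F1))))
          (tl (snd (name (p (v (Fin.FS Fin.F1)))))) <->
        piece (cst c) (fst (name (v Fin.F1))) (snd (name (v Fin.F1)))
          (tl (snd (name (v (Fin.FS Fin.F1))))))).
      { intros Et Hne.
        rewrite (piece_transfer (cst c) M f D), (piece_transfer (cst c') M f' D').
        destruct (fst (name (v (Fin.FS Fin.F1)))) as [|l lam]; [easy|]; simpl in Et.
        apply piece_tl in H2; rewrite Et in H2.
        assert (Hm : forall (h : nat -> M) u, tl (map h u) = map h (tl u)) by (intros h []; easy).
        rewrite !Hm in H2.
        split; intros H.
        - apply piece_trans with (1 := H1), piece_trans with (1 := H); now apply piece_sym.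
        - apply piece_sym in H1; [|easy].
          now apply piece_trans with (1 := H1), piece_trans with (1 := H). }
      tauto.
Qed.

Lemma isoT_ciso (c c' : Code L) : isoT c c' -> ciso (classify c) (classify c').
Proof.
  intros (M & M' & a & a' & Hc & Hc' & g & Hs & Hd & Hi).
  apply classify_invariant with M' (fun n => g (a n)) a'.
  - apply dense_map_iso with M; auto.
    + now apply codes_dense_map.
    + apply polish_tame, Hc'.
  - now apply codes_dense_map.
Qed.
End Forward.

(** * Stabilisation *)

Lemma lastn_lastn {A} n m (l : list A) : (n <= m)%nat -> (m <= length l)%nat ->
  lastn n (lastn m l) = lastn n l.
Proof.
  intros H1 H2; rewrite (lastn_split m l) at 2; rewrite lastn_app; [easy|].
  rewrite lastn_length; lia.
Qed.

Lemma least_nat (Q : nat -> Prop) : (exists k, Q k) ->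
  exists k, Q k /\ forall j, (j < k)%nat -> ~ Q j.
Proof.
  intros [k Hk]; revert Hk; induction k as [k IH] using lt_wf_ind; intros Hk.
  destruct (classic (exists j, (j < k)%nat /\ Q j)) as [[j [Hj Qj]]|Hn]; [eauto|].
  exists k; split; [easy|]; intros j Hj Qj; apply Hn; now exists j.
Qed.

(** The element of [F] chosen for the first entry serves no other entry, so it can be deleted from
    [F] before the induction hypothesis is applied. *)
Lemma pigeonhole {A B} (R : A -> B -> Prop) ls : forall F,
  Forall (fun y => exists g, In g F /\ R g y) ls ->
  ForallOrdPairs (fun y y' => ~ exists g, R g y /\ R g y') ls ->
  (length ls <= length F)%nat.
Proof.
  induction ls as [|y ls IH]; intros F HF HO; simpl; [lia|].
  inversion HF as [|? ? [g [Hg Hgy]] HF']; subst; inversion HO as [|? ? Hy HO']; subst.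
  apply in_split in Hg; destruct Hg as [F1 [F2 ->]].
  specialize (IH (F1 ++ F2)); rewrite length_app in *; simpl.
  enough (length ls <= length F1 + length F2)%nat by lia.
  apply IH; [|easy]; clear IH HO HO' HF.
  rewrite Forall_forall in *; intros y' Hy'.
  destruct (HF' y' Hy') as [g' [Hg' HR]]; exists g'; split; [|easy].
  apply in_app_or in Hg'; destruct Hg' as [H|[<-|H]]; apply in_or_app; auto.
  exfalso; apply (Hy y' Hy'); now exists g.
Qed.

Section Stability.
Context {L : signature} (M : structure L) (T : tame M).

(** The form in which almost local compactness enters the game. *)
Definition tb_dense : Prop :=
  forall x e, 0 < e -> exists y r, dist M x y < e /\ tball M y (pw r).

Lemma tball_shift x y r s : tball M x r -> dist M x y + s <= r -> tball M y s.
Proof.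
  intros H Hr e; destruct (H e) as [F HF]; exists F; intros z Hz; apply HF.
  pose proof (tame_tri M T x y z); lra.
Qed.

Lemma tball_le x r s : tball M x r -> s <= r -> tball M x s.
Proof. intros H Hr; apply tball_shift with x r; [easy|]; rewrite (tame_refl M T); lra. Qed.

Lemma tb_dense_tuple x e : tb_dense -> 0 < e ->
  exists w r, close M e x w /\ Forall (fun z => tball M z (pw r)) w.
Proof.
  intros HD He; induction x as [|a x (w & r & Hw & Hr)].
  - exists [], O; split; constructor.
  - destruct (HD a e He) as (b & s & Hb & Hs); exists (b :: w), (r + s)%nat.
    split; [now constructor|]; constructor.
    + apply tball_le with (pw s); [easy|apply pw_le; lia].
    + apply Forall_impl with (2 := Hr); intros z Hz.
      apply tball_le with (pw r); [easy|apply pw_le; lia].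
Qed.

Lemma tuple_net r w : Forall (fun z => tball M z r) w -> forall e, exists F,
  forall v, close M r v w -> exists g, In g F /\ close M (pw e) g v.
Proof.
  induction 1 as [|a w Ha Hw IH]; intros e.
  - exists [[]]; intros v Hv; inversion Hv; exists []; split; [now left|constructor].
  - destruct (IH e) as [F HF]; destruct (Ha e) as [F0 HF0].
    exists (map (fun p => fst p :: snd p) (list_prod F0 F)).
    intros v Hv; inversion Hv as [|b ? v' ? Hb Hv']; subst.
    destruct (HF v' Hv') as [g [Hg Hgv]].
    destruct (HF0 b) as [y [Hy Hyb]]; [now rewrite (tame_sym M T)|].
    exists (y :: g); split; [|now constructor].
    apply in_map_iff; exists (y, g); split; [easy|]; now apply in_prod.
Qed.

(** Two tuples served by the same point of a net of precision below [s / 2] are [s]-close, so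
    separated tuples cannot outnumber the net. The bound is uniform in [p], hence available before
    the descendant is chosen. *)
Lemma packed_finite r s w : Forall (fun z => tball M z r) w -> 0 < s ->
  exists k, forall p n, packed M p n r s k w.
Proof.
  intros Hw Hs; destruct (pw_small (s / 2)) as [e He]; [lra|].
  destruct (tuple_net r w Hw e) as [F HF]; exists (S (length F)).
  intros p n ws Hl Hws HO.
  enough (length ws <= length F)%nat by lia.
  apply pigeonhole with (R := close M (pw e)).
  - apply Forall_impl with (2 := Hws); intros v [_ Hv]; now apply HF.
  - clear - HO He T; induction HO as [|v vs Hv HO IH]; constructor; [|easy].
    apply Forall_impl with (2 := Hv); intros v' Hn [g [H1 H2]]; apply Hn.
    apply close_mono with (pw e + pw e); [lra|]; apply close_trans with g; auto.
    now apply close_sym.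
Qed.

(** Descent relates pieces, not tuples: the older coordinates of [x'] need only lie in the piece of
    [x], and this is how drift arises. *)
Definition desc (lam : list label) (x : list M) (mu : list label) (x' : list M) : Prop :=
  piece M (mu ++ lam) x' x' /\ piece M lam x (lastn (length lam) x').

Lemma desc_class lam x x' : piece M lam x x' -> desc lam x [] x'.
Proof.
  intros H; split; simpl; [now apply piece_refl_r with x|].
  rewrite lastn_exact; [easy|]. now apply piece_length_r in H.
Qed.

Lemma desc_trans lam x mu x' mu' x'' :
  desc lam x mu x' -> desc (mu ++ lam) x' mu' x'' -> desc lam x (mu' ++ mu) x''.
Proof.
  intros [H1 H2] [H3 H4]; split; [now rewrite <- app_assoc|].
  apply piece_trans with (1 := H2).
  apply piece_app in H4; [|easy]; rewrite lastn_lastn in H4; [easy| |].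
  - rewrite length_app; lia.
  - apply piece_length_l in H3; rewrite H3, !length_app; lia.
Qed.

Lemma desc_child l lam b x : piece M (l :: lam) (b :: x) (b :: x) -> desc lam x [l] (b :: x).
Proof.
  intros H; split; [easy|].
  apply piece_tl in H; simpl in H. pose proof (piece_length_l _ _ _ _ H) as Hl.
  change (b :: x) with ([b] ++ x); rewrite lastn_app by lia.
  now rewrite lastn_exact.
Qed.

Lemma proj_lastn (p : list M -> Prop) n u : p u -> (n <= length u)%nat -> proj p n (lastn n u).
Proof.
  intros Hu Hn; split; [now apply lastn_length|].
  exists (firstn (length u - n) u); now rewrite <- lastn_split.
Qed.

Lemma proj_desc lam x mu x' n l : desc lam x mu x' -> (n <= length lam)%nat ->
  proj (piece M (mu ++ lam) x') n l -> proj (piece M lam x) n l.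
Proof.
  intros [H1 H2] Hn [Hl [e He]].
  assert (Hlen : length (e ++ l) = length (mu ++ lam)) by now apply piece_length_r in He.
  apply piece_app in He; [|easy].
  replace l with (lastn n (lastn (length lam) (e ++ l))).
  - apply proj_lastn; [now apply piece_trans with (1 := H2)|].
    rewrite lastn_length; [easy|]. rewrite Hlen, length_app; lia.
  - rewrite lastn_lastn; [|easy|rewrite Hlen, length_app; lia].
    rewrite lastn_app by lia; now apply lastn_exact.
Qed.

Lemma free_desc lam x bs : piece M lam x x -> exists mu, length mu = length bs /\
  desc lam x mu (bs ++ x).
Proof.
  intros H; induction bs as [|b bs [mu [Hl IH]]].
  - exists []; split; [easy|]; now apply desc_class.
  - exists (Lfree :: mu); split; [simpl; congruence|].
    apply (desc_trans lam x mu (bs ++ x) [Lfree]); [easy|].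
    apply desc_child; split; [split; [apply IH|easy]|now exists O].
Qed.

(** The remedy against drift: the first [n] coordinates already chosen can be recovered, up to
    [pw d], inside every later piece. *)
Definition stable (n d : nat) (lam : list label) (x : list M) : Prop :=
  forall mu x', desc lam x mu x' -> forall l, proj (piece M lam x) n l ->
    exists l', proj (piece M (mu ++ lam) x') n l' /\ close M (pw d) l l'.

Lemma stable_desc n d lam x mu x' : (n <= length lam)%nat -> stable n d lam x ->
  desc lam x mu x' -> stable n d (mu ++ lam) x'.
Proof.
  intros Hn HS HD mu' x'' HD' l Hl; rewrite app_assoc.
  apply HS; [now apply desc_trans with x'|]. now apply proj_desc with mu x'.
Qed.

(* Along a chain in the piece, a first point far from the projection of a descendant would
   contribute one more separated tuple than the minimal packing number allows. *)
Lemma stabilise (b0 : M) lam x n N : tb_dense -> piece M lam x x -> (n <= length lam)%nat ->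
  exists d mu x', (N <= d)%nat /\ desc lam x mu x' /\ (0 < length mu)%nat /\
    stable n d (mu ++ lam) x'.
Proof.
  intros HTB Hx Hn.
  destruct (piece_open M T lam x Hx) as [r [Hr Hopen]].
  (* Moving inside the piece to points with totally bounded balls makes the packing numbers
     finite. *)
  destruct (tb_dense_tuple x r HTB Hr) as (w0 & r0 & Hw0 & Hr0).
  apply Hopen in Hw0; clear r Hr Hopen.
  (* The 2 makes the radius [2 * pw d], with its slack, fit into [pw r0]; [N] is the precision asked
     for. *)
  set (d := (N + r0 + 2)%nat).
  assert (Hd : 4 * pw d <= pw r0).
  { assert (pw d <= pw (S (S r0))) by (apply pw_le; unfold d; lia).
    rewrite !pw_S in H; lra. }
  pose proof (pw_pos d) as Hdp.
  (* The length requirement bounds the chain steps of the next level by [pw d]. *)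
  set (Q := fun k => exists mu x', (d <= length (mu ++ lam))%nat /\ desc lam x mu x' /\
    exists h, packed M (piece M (mu ++ lam) x') n (2 * pw d + pw h) (pw d - pw h) k
      (lastn n x')).
  assert (HQ : exists k, Q k).
  { pose proof (piece_length_r M T _ _ _ Hw0) as Hlw.
    destruct (packed_finite (pw r0) (pw d - pw (S d)) (lastn n w0)) as [k Hk].
    { rewrite (lastn_split n w0) in Hr0; now apply Forall_app in Hr0. }
    { rewrite pw_S; lra. }
    destruct (free_desc lam w0 (repeat b0 d)) as [mu [Hmu HD]]; [now apply piece_refl_r with x|].
    rewrite repeat_length in Hmu.
    exists k, mu, (repeat b0 d ++ w0); split; [rewrite length_app; lia|]; split.
    { rewrite <- (app_nil_r mu); apply desc_trans with w0; [now apply desc_class|easy]. }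
    exists (S d); rewrite lastn_app by lia.
    intros ws Hl HF; apply (Hk (piece M (mu ++ lam) (repeat b0 d ++ w0)) n); [easy|].
    apply Forall_impl with (2 := HF); intros v [H1 H2]; split; [easy|].
    apply close_mono with (2 := H2); rewrite pw_S; lra. }
  destruct (least_nat Q HQ) as [k [(mu1 & x1 & Hd1 & HD1 & h1 & Hp1) Hmin]]; clear HQ.
  (* Turned into a label, the minimal bound holds around all tuples of the new piece, not only
     around [x1]. The added coordinate [b0] is a filler. *)
  set (lam1 := mu1 ++ lam) in *; set (lam2 := Lstab n d k :: lam1); set (x2 := b0 :: x1).
  assert (Hn1 : (n <= length lam1)%nat) by (unfold lam1; rewrite length_app; lia).
  assert (Hx2 : piece M lam2 x2 x2).
  { split; [|now exists O]; split; [apply HD1|]; now exists h1. }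
  assert (HD2 : desc lam x (Lstab n d k :: mu1) x2).
  { apply (desc_trans lam x mu1 x1 [Lstab n d k]); [easy|]; now apply desc_child. }
  exists d, (Lstab n d k :: mu1), x2; split; [unfold d; lia|]; split; [easy|].
  split; [simpl; lia|]; change ((Lstab n d k :: mu1) ++ lam) with lam2.
  intros mu3 x3 HD3 l [Hl [e He]].
  assert (Hlen2 : length lam2 = S (length lam1)) by easy.
  assert (Hx3 : piece M (mu3 ++ lam2) x3 x3) by apply HD3.
  assert (Hlx3 : length x3 = (length mu3 + length lam2)%nat)
    by (apply piece_length_l in Hx3; now rewrite Hx3, length_app).
  (* This property holds at the truncation [u0] of the descendant and is propagated along a chain
     from [u0] to [e ++ l]. *)
  set (good := fun u => exists l', proj (piece M (mu3 ++ lam2) x3) n l' /\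
    close M (pw d) (lastn n u) l').
  set (u0 := lastn (length lam2) x3).
  assert (Hu0 : piece M lam2 u0 (e ++ l)).
  { apply piece_trans with x2; [apply piece_sym; [easy|apply HD3]|easy]. }
  assert (Hg0 : good u0).
  { exists (lastn n x3); split; [apply proj_lastn; [easy|lia]|].
    unfold u0; rewrite lastn_lastn by lia; now apply close_refl. }
  enough (Hge : good (e ++ l)).
  { unfold good in Hge; rewrite lastn_app, lastn_exact in Hge by lia; exact Hge. }
  destruct Hu0 as [Ha [m Hm]]; revert Hm; generalize (e ++ l); clear l Hl e He.
  induction m as [|m IHm]; intros v Hv; [simpl in Hv; now subst|].
  destruct Hv as [u [Hu Hs]]; pose proof (IHm u Hu) as [l' [Hl' Hc]].
  apply NNPP; intros Hbad.
  assert (Hpv : piece M lam2 x2 v).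
  { apply piece_trans with u0; [apply HD3|]; split; [easy|]; exists (S m), u; now split. }
  set (z := lastn n v).
  (* The projection [z] of the first bad tuple is within [2 * pw d] of [l']: one [pw d] for the
     chain step, one for the goodness of [u]. Hence the radius in [Lstab]. *)
  assert (Hlv : length v = length lam2) by now apply piece_length_r in Hpv.
  assert (Hzl : close M (2 * pw d) z l').
  { apply close_mono with (pw d + pw d); [lra|].
    apply close_trans with (lastn n u); [easy| |easy].
    apply close_lastn, close_sym; [easy|].
    apply close_mono with (pw (length lam1)); [now apply pw_le|apply Hs]. }
  pose proof Hl' as Hl''; destruct Hl' as [Hln [e' He']].
  set (x3' := e' ++ l') in *.
  assert (Hll : lastn n x3' = l') by (unfold x3'; rewrite lastn_app, lastn_exact by lia; easy).
  assert (Hlx : length x3' = (length mu3 + length lam2)%nat)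
    by (apply piece_length_r in He'; [now rewrite He', length_app|easy]).
  assert (Hpu : piece M lam2 x2 (lastn (length lam2) x3')).
  { apply piece_trans with u0; [apply HD3|]; now apply piece_app in He'. }
  pose proof (piece_adm_r _ _ _ _ _ Hpu) as Hadm.
  pose proof (piece_tl _ _ _ _ _ Hpu) as Htl.
  assert (Hlt : lastn n (lastn (length lam2) x3') = l') by (rewrite lastn_lastn by lia; easy).
  destruct (lastn (length lam2) x3') as [|c' t'] eqn:Eu; [easy|].
  destruct Hadm as [_ [h Hh]]; simpl in Htl.
  assert (Hlt' : length t' = length lam1) by now apply piece_length_r in Htl.
  assert (Hl't : lastn n t' = l').
  { rewrite <- Hlt; change (c' :: t') with ([c'] ++ t'); rewrite lastn_app by lia; easy. }
  rewrite Hl't in Hh.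
  (* By minimality the descendant [x3'] cannot have the smaller bound [k]. It is shown to have it,
     since [k] separated tuples [ws] near [l'] in its projection would, together with [z], violate
     the label bound [S k] at [l']. *)
  destruct k as [|k]; [now apply (Hh []); [| |constructor]|].
  apply (Hmin k); [lia|].
  exists (mu3 ++ Lstab n d (S k) :: mu1), x3'.
  assert (Eapp : (mu3 ++ Lstab n d (S k) :: mu1) ++ lam = mu3 ++ lam2)
    by (rewrite <- app_assoc; easy).
  split; [rewrite Eapp, length_app; lia|]; split.
  { apply (desc_trans lam x (Lstab n d (S k) :: mu1) x2); [easy|].
    split; [now apply piece_refl_r with x3|]; change (piece M lam2 x2 (lastn (length lam2) x3')).
    now rewrite Eu. }
  exists h; rewrite Eapp, Hll; intros ws Hws HF HO.
  assert (HD3' : desc lam2 x2 mu3 x3').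
  { split; [now apply piece_refl_r with x3|]; now rewrite Eu. }
  (* [Lstab] counts in the projection of the parent piece, which contains the projections of the
     piece and of its descendants. *)
  assert (Hsub : forall v, proj (piece M lam2 x2) n v -> proj (piece M lam1 t') n v).
  { intros v' [H1 [e1 H2]].
    assert (Hc1 : proj (piece M lam1 x1) n v').
    { apply (proj_desc lam1 x1 [Lstab n d (S k)] x2); [now apply desc_child|easy|].
      split; [easy|now exists e1]. }
    destruct Hc1 as [_ [e2 H3]]; split; [easy|]; exists e2.
    apply piece_trans with x1; [now apply piece_sym|easy]. }
  apply (Hh (z :: ws)).
  - simpl; congruence.
  - constructor.
    + split; [apply Hsub, proj_lastn; [easy|lia]|].
      apply close_mono with (2 := Hzl); pose proof (pw_pos h); lra.
    + apply Forall_impl with (2 := HF); intros v' [H1 H2]; split; [|easy].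
      apply Hsub, (proj_desc lam2 x2 mu3 x3'); [easy|lia|easy].
  - constructor; [|easy].
    apply Forall_impl with (2 := HF); intros v' [H1 H2] Hcl; apply Hbad.
    exists v'; split.
    + destruct H1 as [H1 [e1 H3]]; split; [easy|]; exists e1.
      now apply piece_trans with x3'.
    + apply close_mono with (2 := Hcl); pose proof (pw_pos h); lra.
Qed.
End Stability.

(** * Requirements met along a branch *)

(** [Tnear] and [Tnet] serve the density of the limits, [Tdist] and [Tpred] the agreement of
    distances and predicates on the two sides. *)
Inductive task : Type :=
| Tnear (m q : nat)
| Tnet (j D e : nat)
| Tdist (i j c : nat)
| Tpred (q : nat) (v : list nat) (c : nat).

Lemma countable_task : countable task.
Proof.
  apply (@countable_inj _ (nat * list nat * list nat) (fun l => match l with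
    | Tnear m q => (0, [m; q], [])
    | Tnet j D e => (1, [j; D; e], [])
    | Tdist i j c => (2, [i; j; c], [])
    | Tpred q v c => (3, [q; c], v)
    end)%nat).
  - intros [] [] H; try discriminate H; try injection H; intros; subst; easy.
  - auto using countable_prod, countable_list, countable_nat.
Qed.

Section Tasks.
Context {L : signature} (M : structure L) (T : tame M) (a : nat -> M).

Definition coord (x : list M) (i : nat) : M := nth i (rev x) (a O).

Lemma coord_lastn x K i : (i < K)%nat -> (K <= length x)%nat ->
  coord (lastn K x) i = coord x i.
Proof.
  intros Hi HK; unfold coord; rewrite (lastn_split K x) at 2.
  rewrite nth_rev_app; [easy|]. rewrite lastn_length; lia.
Qed.

Lemma get_coord b t i : (i < S (length t))%nat -> get b t i = coord (b :: t) i.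
Proof.
  intros H; unfold get, coord; apply nth_indep; now rewrite length_rev.
Qed.

Lemma in_lastn_coord y K x : (K <= length x)%nat -> In y (lastn K x) ->
  exists i, (i < K)%nat /\ coord x i = y.
Proof.
  intros HK Hy; apply in_rev in Hy; apply (In_nth _ _ (a O)) in Hy.
  destruct Hy as [i [Hi He]]; rewrite length_rev, lastn_length in Hi by easy.
  exists i; split; [easy|]; rewrite <- (coord_lastn x K i Hi HK); exact He.
Qed.

(** Achievements are recorded through labels and pieces, which persist when tuples move. [Tnear]
    therefore promises only that some [w] near [a m] shares a piece with the current tuple; [r + 3]
    makes the chain steps there at most an eighth of [pw r]. *)
Definition done (tau : task) (x : list M) (lam' : list label) (x' : list M) : Prop :=
  match tau with
  | Tnear m q => exists w r mu lam1 x1, dist M (a m) w < pw q /\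
      (r + 3 <= length lam1)%nat /\ lam' = mu ++ Ltb r :: lam1 /\
      piece M (Ltb r :: lam1) (w :: x1) (lastn (S (length lam1)) x')
  | Tnet j D e => (j < length x)%nat -> (exists h, tball M (coord x j) (pw D + pw h)) ->
      exists mu lam1, lam' = mu ++ Lnet j D e :: lam1 /\ (length x <= length lam1)%nat
  | Tdist i j c => (i < length x)%nat -> (j < length x)%nat ->
      exists mu lam1 p q, lam' = mu ++ Ldist i j p q c :: lam1 /\ (length x <= length lam1)%nat
  | Tpred q v c => Forall (fun i => i < length x)%nat v ->
      exists mu lam1 p p', lam' = mu ++ Lpred q v p p' c :: lam1 /\
        (length x <= length lam1)%nat
  end.

Lemma done_desc tau x lam' x' mu x'' : done tau x lam' x' -> desc M lam' x' mu x'' ->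
  done tau x (mu ++ lam') x''.
Proof.
  intros H HD; destruct tau as [m q|j D e|i j c|q v c]; cbn [done] in *.
  - destruct H as (w & r & mu' & lam1 & x1 & H1 & H2 & -> & H4).
    exists w, r, (mu ++ mu'), lam1, x1; split; [easy|]; split; [easy|].
    split; [now rewrite app_assoc|].
    apply piece_trans with (1 := H4).
    destruct HD as [H5 H6]; apply piece_app in H6; [|easy].
    rewrite lastn_lastn in H6; [exact H6|rewrite length_app; lia|].
    apply piece_length_l in H5; rewrite H5, !length_app; lia.
  - intros H1 H2; destruct (H H1 H2) as (mu' & lam1 & -> & H3).
    exists (mu ++ mu'), lam1; now rewrite app_assoc.
  - intros H1 H2; destruct (H H1 H2) as (mu' & lam1 & p & q & -> & H3).
    exists (mu ++ mu'), lam1, p, q; now rewrite app_assoc.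
  - intros H1; destruct (H H1) as (mu' & lam1 & p & p' & -> & H3).
    exists (mu ++ mu'), lam1, p, p'; now rewrite app_assoc.
Qed.

Lemma singleton_piece l lam b t : piece M lam t t -> cond M l (piece M lam t) b t ->
  piece M (l :: lam) (b :: t) (b :: t).
Proof. intros H1 H2; split; [now split|now exists O]. Qed.

Lemma do_task tau lam x : tb_dense M -> piece M lam x x ->
  exists mu x', desc M lam x mu x' /\ done tau x (mu ++ lam) x'.
Proof.
  intros HTB Hx; pose proof (piece_length_l _ _ _ _ Hx) as Hlen.
  assert (Htriv : forall P, (P -> exists mu x', desc M lam x mu x' /\ done tau x (mu ++ lam) x') ->
    (~ P -> done tau x lam x) -> exists mu x', desc M lam x mu x' /\ done tau x (mu ++ lam) x').
  { intros P HP HN; destruct (classic P) as [H|H]; [auto|].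
    exists [], x; split; [now apply desc_class|]; now apply HN. }
  destruct tau as [m q|j D e|i j c|q v c].
  - destruct (HTB (a m) (pw q) (pw_pos q)) as (w & r & Hw & Hr).
    (* Padding to level at least [S r + 3]: the label will be [Ltb (S r)], as half of the radius
       [pw r] is spent on slack. *)
    destruct (free_desc M T lam x (repeat w (r + 4))) as [mu [Hmu HD]]; [easy|].
    rewrite repeat_length in Hmu; set (x1 := repeat w (r + 4) ++ x) in *.
    assert (Hp : piece M (Ltb (S r) :: mu ++ lam) (w :: x1) (w :: x1)).
    { apply singleton_piece; [apply HD|]. exists (S r).
      apply tball_le with (pw r); [easy|easy|]. rewrite pw_S; lra. }
    pose proof (piece_length_l _ _ _ _ (proj1 HD)) as Hl1.
    exists (Ltb (S r) :: mu), (w :: x1); split.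
    + apply (desc_trans M T lam x mu x1 [Ltb (S r)]); [easy|]; now apply desc_child.
    + exists w, (S r), [], (mu ++ lam), x1; split; [easy|].
      split; [rewrite length_app; lia|]; split; [easy|].
      rewrite lastn_exact by (simpl; congruence); easy.
  - apply (Htriv ((j < length x)%nat /\ exists h, tball M (coord x j) (pw D + pw h))).
    2:{ simpl; intros Hn H1 H2; exfalso; apply Hn; now split. }
    intros [Hj [h Hh]]; destruct (Hh (S e)) as [F HF].
    (* A net of precision [pw (S e)] becomes part of the tuple; the filler [a O] then carries the
       label. Slack [pw (S (h + e))] is at most both [pw h] and [pw (S e)]. *)
    destruct (free_desc M T lam x F) as [mu [Hmu HD]]; [easy|].
    pose proof (piece_length_l _ _ _ _ (proj1 HD)) as Hl1.
    rewrite length_app, (length_app mu) in Hl1.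
    assert (Hp : piece M (Lnet j D e :: mu ++ lam) (a O :: F ++ x) (a O :: F ++ x)).
    { apply singleton_piece; [apply HD|].
      exists (S (h + e)); rewrite get_coord by (rewrite length_app; lia).
      unfold coord; change (a O :: F ++ x) with ((a O :: F) ++ x); rewrite nth_rev_app by easy.
      intros z Hz; destruct (HF z) as [y [Hy Hyz]].
      - pose proof (pw_le h (S (h + e))); change (dist M (coord x j) z < pw D + pw h).
        unfold coord; assert (pw (S (h + e)) <= pw h) by (apply H; lia); lra.
      - exists y; split; [simpl; right; apply in_or_app; now left|].
        assert (pw (S (h + e)) <= pw (S e)) by (apply pw_le; lia).
        rewrite (pw_S e) in *; lra. }
    exists (Lnet j D e :: mu), (a O :: F ++ x); split.
    + apply (desc_trans M T lam x mu (F ++ x) [Lnet j D e]); [easy|]; now apply desc_child.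
    + intros _ _; exists [], (mu ++ lam); split; [easy|]; rewrite length_app; lia.
  - apply (Htriv ((i < length x)%nat /\ (j < length x)%nat)).
    2:{ simpl; intros Hn H1 H2; exfalso; apply Hn; now split. }
    intros [Hi Hj].
    destruct (pw_approx (dist M (get (a O) x i) (get (a O) x j)) c) as (p & q & Hpq).
    exists [Ldist i j p q c], (a O :: x); split.
    + apply desc_child, singleton_piece; easy.
    + intros _ _; exists [], lam, p, q; split; [easy|lia].
  - apply (Htriv (Forall (fun i => i < length x)%nat v)); [|simpl; easy].
    intros Hv.
    assert (HP : exists p p', cond M (Lpred q v p p' c) (piece M lam x) (a O) x).
    { destruct (classic (exists P, pred_code L P = q)) as [[P HP]|HP].
      - destruct (pw_approx (interp M P (fun k =>
          get (a O) x (nth (proj1_sig (Fin.to_nat k)) v 0%nat))) c) as (p & p' & Hpp).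
        exists p, p'; intros P' HP'.
        assert (P' = P) as -> by (apply (pred_code_inj L); congruence). exact Hpp.
      - exists O, O; intros P HP'; exfalso; eauto. }
    destruct HP as (p & p' & HP).
    exists [Lpred q v p p' c], (a O :: x); split.
    + now apply desc_child, singleton_piece.
    + intros _; exists [], lam, p, p'; split; [easy|lia].
Qed.

(** Truncating a valid tuple to an earlier level gives a tuple satisfying the label of that level;
    indices need no shift because coordinates are counted from the oldest. *)
Lemma label_persists mu l lam x : piece M (mu ++ l :: lam) x x ->
  exists b t, lastn (S (length lam)) x = b :: t /\ length t = length lam /\
    cond M l (piece M lam t) b t /\
    forall i, (i < S (length lam))%nat -> get b t i = coord x i.
Proof.
  intros H; pose proof (piece_length_l _ _ _ _ H) as Hl; rewrite length_app in Hl; simpl in Hl.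
  apply piece_app in H; [|easy].
  change (length (l :: lam)) with (S (length lam)) in H.
  assert (Hll := lastn_length (S (length lam)) x ltac:(lia)).
  assert (Hco : forall i, (i < S (length lam))%nat -> coord (lastn (S (length lam)) x) i = coord x i).
  { intros i Hi; apply coord_lastn; lia. }
  destruct (lastn (S (length lam)) x) as [|b t]; [easy|].
  exists b, t; split; [easy|]; split; [simpl in Hll; lia|].
  destruct H as [[_ H] _]; split; [easy|].
  intros i Hi; rewrite <- Hco by easy; apply get_coord; simpl in Hll; lia.
Qed.
End Tasks.

(** * Limits along a branch *)

Definition eventually (P : nat -> Prop) : Prop := exists N, forall t, (N <= t)%nat -> P t.

Lemma eventually_and P Q : eventually P -> eventually Q -> eventually (fun t => P t /\ Q t).
Proof.
  intros [N HN] [N' HN']; exists (Nat.max N N'); intros t Ht; split; [apply HN|apply HN']; lia.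
Qed.

Lemma eventually_ge N : eventually (fun t => (N <= t)%nat).
Proof. now exists N. Qed.

Lemma eventually_pw r : 0 < r -> eventually (fun t => 2 * pw t < r).
Proof.
  intros Hr; destruct (pw_small (r / 2)) as [N HN]; [lra|]; exists N; intros t Ht.
  pose proof (pw_le N t Ht); lra.
Qed.

Lemma fun_choice {A B} (R : A -> B -> Prop) :
  (forall x, exists y, R x y) -> exists f, forall x, R x (f x).
Proof.
  intros H; exists (fun x => proj1_sig (constructive_indefinite_description _ (H x))).
  intros x; apply proj2_sig.
Qed.

Section Run.
Context {L : signature} (M : structure L) (HM : polish M) (a : nat -> M).
Context (Ha : forall z e, 0 < e -> exists m, dist M (a m) z < e).
Context (sched : nat -> task).
Context (Hsched : forall tau N, exists t, (N <= t)%nat /\ sched t = tau).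

Let T : tame M := polish_tame M HM.

(** One side of the game: [n t] is the number of coordinates whose movement is controlled at stage
    [t]. In [run_done], [u] is the tuple on which the task was performed; it may differ slightly
    from [x t] on the controlled coordinates. *)
Record run (lam : nat -> list label) (x : nat -> list M) (n : nat -> nat) : Prop := {
  run_valid : forall t, piece M (lam t) (x t) (x t);
  run_desc : forall t, exists mu, lam (S t) = mu ++ lam t /\ desc M (lam t) (x t) mu (x (S t));
  run_le : forall t, (n t <= length (lam t))%nat;
  run_next : forall t, n (S t) = length (lam t);
  run_lt : forall t, (length (lam t) < length (lam (S t)))%nat;
  run_close : forall t, close M (pw t) (lastn (n t) (x t)) (lastn (n t) (x (S t)));
  run_done : forall t, exists u, (length (lam t) <= length u)%nat /\
    close M (pw t) (lastn (n t) (x t)) (lastn (n t) u) /\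
    done M a (sched t) u (lam (S t)) (x (S t)) }.

Context (lam : nat -> list label) (x : nat -> list M) (n : nat -> nat) (HR : run lam x n).

Let X t i := coord M a (x t) i.

Lemma run_length t : length (x t) = length (lam t).
Proof. apply (piece_length_l M) with (x t), (run_valid _ _ _ HR). Qed.

Lemma run_desc_le t t' : (t <= t')%nat -> exists mu, lam t' = mu ++ lam t /\
  desc M (lam t) (x t) mu (x t').
Proof.
  induction 1 as [|t' Ht [mu [E HD]]].
  - exists []; split; [easy|]; apply desc_class; [exact T|apply (run_valid _ _ _ HR)].
  - destruct (run_desc _ _ _ HR t') as [mu' [E' HD']].
    exists (mu' ++ mu); split; [now rewrite E', E, app_assoc|].
    rewrite E in HD'; now apply (desc_trans M T _ _ mu (x t')).
Qed.

Lemma run_n_mono t t' : (t <= t')%nat -> (n t <= n t')%nat.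
Proof.
  induction 1 as [|t' _ IH]; [lia|].
  rewrite (run_next _ _ _ HR t'); pose proof (run_le _ _ _ HR t'); lia.
Qed.

Lemma run_n_grows i : eventually (fun t => (i < n t)%nat).
Proof.
  assert (H : forall t, (t <= length (lam t))%nat).
  { induction t as [|t IH]; [lia|]; pose proof (run_lt _ _ _ HR t); lia. }
  exists (S (S i)); intros [|t] Ht; [lia|].
  rewrite (run_next _ _ _ HR t); specialize (H t); lia.
Qed.

Lemma run_step t i : (i < n t)%nat -> dist M (X t i) (X (S t) i) < pw t.
Proof.
  intros Hi; unfold X.
  pose proof (run_le _ _ _ HR t); pose proof (run_lt _ _ _ HR t).
  rewrite <- (coord_lastn M a (x t) (n t) i), <- (coord_lastn M a (x (S t)) (n t) i);
    try rewrite run_length; try lia.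
  apply close_nth; [apply (run_close _ _ _ HR)|].
  rewrite (tame_refl M T); apply pw_pos.
Qed.

(** The right-hand side is the geometric sum of [pw s] for [t <= s < t']. *)
Lemma run_cauchy t t' i : (i < n t)%nat -> (t <= t')%nat ->
  dist M (X t i) (X t' i) <= 2 * pw t - 2 * pw t'.
Proof.
  intros Hi; induction 1 as [|t' Ht IH]; [rewrite (tame_refl M T); lra|].
  pose proof (run_step t' i) as H; pose proof (run_n_mono t t' Ht).
  specialize (H ltac:(lia)).
  pose proof (tame_tri M T (X t i) (X t' i) (X (S t') i)).
  rewrite pw_S; lra.
Qed.

Lemma run_limit : exists l : nat -> M, forall i t, (i < n t)%nat ->
  dist M (X t i) (l i) <= 2 * pw t.
Proof.
  apply (fun_choice (fun i y => forall t, (i < n t)%nat -> dist M (X t i) y <= 2 * pw t)).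
  intros i; destruct (run_n_grows i) as [t0 Ht0].
  pose proof HM as (_ & _ & _ & _ & _ & Hcomp & _).
  destruct (Hcomp (fun s => X (t0 + s) i)) as [y Hy].
  { intros e He; destruct (eventually_pw (e / 2)) as [N HN]; [lra|].
    assert (Hb : forall s, (N <= s)%nat -> dist M (X (t0 + N) i) (X (t0 + s) i) < e / 2).
    { intros s Hs; pose proof (run_cauchy (t0 + N) (t0 + s) i).
      specialize (H (Ht0 (t0 + N)%nat ltac:(lia)) ltac:(lia)).
      specialize (HN (t0 + N)%nat ltac:(lia)); pose proof (pw_pos (t0 + s)); lra. }
    exists N; intros s s' Hs Hs'.
    pose proof (tame_tri M T (X (t0 + s) i) (X (t0 + N) i) (X (t0 + s') i)).
    rewrite (tame_sym M T (X (t0 + s) i) (X (t0 + N) i)) in H.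
    pose proof (Hb s Hs); pose proof (Hb s' Hs'); lra. }
  exists y; intros t Ht; apply le_epsilon; intros e He.
  destruct (Hy e He) as [N HN].
  specialize (HN (N + t)%nat ltac:(lia)).
  pose proof (run_cauchy t (t0 + (N + t)) i Ht ltac:(lia)).
  pose proof (tame_tri M T (X t i) (X (t0 + (N + t)) i) y).
  pose proof (pw_pos (t0 + (N + t))); lra.
Qed.

Context (l : nat -> M) (Hl : forall i t, (i < n t)%nat -> dist M (X t i) (l i) <= 2 * pw t).

Let adherent (z : M) : Prop := forall e, 0 < e -> exists i, dist M (l i) z < e.

(** A late [Tnet] task puts a net of the ball among the coordinates; its label persists, so the
    moving coordinates still form a net when they are close to their limits. *)
Lemma ball_adherent j D h z : tball M (l j) (pw D + pw h) -> dist M (l j) z < pw D ->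
  adherent z.
Proof.
  intros HB Hz e He; destruct (pw_small (e / 2)) as [q Hq]; [lra|].
  destruct (eventually_and _ _ (run_n_grows j) (eventually_pw (pw (S (S h))) (pw_pos _))) as [N HN].
  destruct (Hsched (Tnet j D q) N) as [t [Ht Et]].
  destruct (HN t Ht) as [Hj Hpt]; clear N HN Ht.
  destruct (run_done _ _ _ HR t) as (v & Hv & Hvc & Hdone); rewrite Et in Hdone.
  pose proof (run_le _ _ _ HR t) as Hle.
  destruct Hdone as (mu & lam1 & E & Hlen); [lia| |].
  (* The task sees coordinate [j] of [v] instead of [l j]; the error, at most [3 * pw t], is below
     half of the slack [pw h]. *)
  { exists (S h); apply (tball_shift M T (l j) _ (pw D + pw h)); [easy|].
    pose proof (Hl j t Hj) as H; rewrite (tame_sym M T) in H; unfold X in H.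
    assert (Hcv : dist M (coord M a (x t) j) (coord M a v j) < pw t).
    { rewrite <- (coord_lastn M a (x t) (n t) j), <- (coord_lastn M a v (n t) j);
        try rewrite run_length; try lia.
      apply close_nth; [easy|]; rewrite (tame_refl M T); apply pw_pos. }
    pose proof (tame_tri M T (l j) (coord M a (x t) j) (coord M a v j)).
    pose proof (pw_pos t); rewrite !pw_S in *; lra. }
  set (K := S (length lam1)).
  destruct (eventually_and _ _ (eventually_ge (S t)) (eventually_and _ _ (run_n_grows K)
    (eventually_and _ _ (eventually_pw (e / 2) ltac:(lra))
      (eventually_pw (pw D - dist M (l j) z) ltac:(lra))))) as [N HN].
  destruct (HN N (Nat.le_refl N)) as (H1 & H2 & H3 & H4); clear HN.
  destruct (run_desc_le (S t) N H1) as [mu' [E' _]]; rewrite E, app_assoc in E'.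
  pose proof (run_valid _ _ _ HR N) as HV; rewrite E' in HV.
  destruct (label_persists M T a _ _ _ _ HV) as (b & u & Eu & Hu & [h' Hnet] & Hget).
  pose proof (run_n_mono t N ltac:(lia)) as Hmono.
  pose proof (run_length t) as Hlt.
  destruct (Hnet z) as [y [Hy Hyz]].
  { rewrite Hget by lia. pose proof (Hl j N ltac:(lia)) as HlN; unfold X in HlN.
    pose proof (tame_tri M T (coord M a (x N) j) (l j) z); pose proof (pw_pos h'); lra. }
  pose proof (run_le _ _ _ HR N) as HleN; pose proof (run_length N) as HlenN.
  rewrite <- Eu in Hy; destruct (in_lastn_coord M a y K (x N)) as [i [Hi Hiy]];
    [lia|exact Hy|].
  exists i; pose proof (Hl i N ltac:(lia)) as HlN; unfold X in HlN; rewrite Hiy in HlN.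
  pose proof (tame_tri M T (l i) y z); rewrite (tame_sym M T (l i) y) in H.
  pose proof (pw_pos h'); lra.
Qed.

(* Chains through points with totally bounded balls cannot leave the set of limit points. *)
Lemma run_dense z e : 0 < e -> exists i, dist M (l i) z < e.
Proof.
  intros He; destruct (Ha z (e / 3) ltac:(lra)) as [m Hm].
  destruct (pw_small (e / 3) ltac:(lra)) as [q Hq].
  destruct (Hsched (Tnear m q) O) as [t [_ Et]].
  destruct (run_done _ _ _ HR t) as (v0 & _ & _ & Hdone); rewrite Et in Hdone.
  destruct Hdone as (w & r & mu & lam1 & x1 & Hw & Hr & E & HP).
  enough (Hadh : adherent w).
  { destruct (Hadh (e / 3) ltac:(lra)) as [i Hi]; exists i.
    pose proof (tame_tri M T (l i) w z); pose proof (tame_tri M T w (a m) z).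
    rewrite (tame_sym M T w (a m)) in H0; lra. }
  set (K := length lam1).
  destruct (eventually_and _ _ (eventually_ge (S t)) (eventually_and _ _ (run_n_grows K)
    (eventually_pw (pw (r + 3)) (pw_pos _)))) as [N HN].
  destruct (HN N (Nat.le_refl N)) as (H1 & H2 & H3); clear HN.
  destruct (run_desc_le (S t) N H1) as [mu' [E' HD]]; rewrite E, app_assoc in E'.
  pose proof (run_le _ _ _ HR N) as HleN; pose proof (run_length N) as HlenN.
  assert (HP' : piece M (Ltb r :: lam1) (w :: x1) (lastn (S K) (x N))).
  { apply piece_trans with (1 := HP); destruct HD as [HD1 HD2].
    rewrite E in HD2; apply piece_app in HD2; [|exact T].
    rewrite lastn_lastn in HD2; [exact HD2|rewrite length_app; lia|].
    rewrite HlenN, E', <- app_assoc, !length_app; simpl; lia. }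
  apply piece_sym in HP'; [|exact T].
  assert (Hu : pw r = 8 * pw (r + 3) /\ pw (S r) = 4 * pw (r + 3) /\
    pw (S (S r)) = 2 * pw (r + 3)).
  { replace (r + 3)%nat with (S (S (S r))) by lia; rewrite !pw_S; lra. }
  destruct Hu as (Hu1 & Hu2 & Hu3); pose proof (pw_pos (r + 3)) as Hu0.
  (* In units of [pw (r + 3)]: a limit within 1 of [b] keeps a totally bounded ball of radius 7,
     enough for [4 + 2], and [b'] is at distance below 2, well inside the radius 4 in which all
     points are adherent. *)
  assert (Hkey : forall b b' j, (exists h, tball M b (pw r + pw h)) ->
    dist M (l j) b <= pw (r + 3) -> dist M b b' < pw (r + 3) -> adherent b').
  { intros b b' j [h Hh] Hj Hb; apply ball_adherent with j (S r) (S (S r)).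
    - apply (tball_shift M T b _ (pw r + pw h)); [easy|].
      rewrite (tame_sym M T); pose proof (pw_pos h); lra.
    - pose proof (tame_tri M T (l j) b b'); lra. }
  assert (HlN : length (lam N) = (length (mu' ++ mu) + S K)%nat) by (rewrite E', length_app; easy).
  assert (HX : coord M a (x N) K = coord M a (lastn (S K) (x N)) K)
    by (symmetry; apply coord_lastn; lia).
  pose proof (lastn_length (S K) (x N) ltac:(lia)) as Hll.
  destruct HP' as [Hadm [s Hs]].
  (* The chain starts at coordinate [K] of [x N], which is near the limit [l K], and ends at [w]. *)
  assert (Hchain : forall s v, reach (step M (Ltb r) (piece M lam1) (pw (length lam1))) s
    (lastn (S K) (x N)) v -> match v with [] => False | b :: _ => adherent b end).
  { clear s Hs; induction s as [|s IH]; intros v Hv.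
    - simpl in Hv; subst v. destruct (lastn (S K) (x N)) as [|b u]; [easy|].
      destruct Hadm as [_ Hb]. apply (Hkey b b K Hb).
      + assert (HXb : coord M a (b :: u) K = b).
        { unfold coord; simpl; simpl in Hll; rewrite app_nth2; rewrite length_rev; [|lia].
          replace (K - length u)%nat with O by lia; easy. }
        pose proof (Hl K N H2) as HK; unfold X in HK; rewrite HX, HXb in HK.
        rewrite (tame_sym M T); lra.
      + rewrite (tame_refl M T); easy.
    - destruct Hv as [u [Hu (Hau & Hav & _ & Hc)]]; specialize (IH u Hu).
      destruct u as [|b u]; [easy|]; destruct v as [|b' v]; [easy|].
      destruct Hau as [_ Hb]; destruct (IH (pw (r + 3)) Hu0) as [j Hj].
      apply (Hkey b b' j Hb); [lra|]. inversion Hc; subst.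
      pose proof (pw_le (r + 3) (length lam1) Hr); lra. }
  exact (Hchain s _ Hs).
Qed.
End Run.

(** * Isomorphism from matching dense sequences *)

(** Indices along which [a] tends to [x] make [b] Cauchy, since the two sequences have the same
    distances. *)
Lemma matched_point {L} (M N : structure L) (a : nat -> M) (b : nat -> N) :
  tame M -> polish N -> (forall z e, 0 < e -> exists i, dist M (a i) z < e) ->
  (forall i j, dist M (a i) (a j) = dist N (b i) (b j)) -> forall x : M, exists y : N, forall e, 0 < e ->
  exists i, dist M (a i) x < e /\ dist N (b i) y < e.
Proof.
  intros TM HN Ha Hd x.
  destruct (fun_choice (fun k i => dist M (a i) x < pw k)) as [s Hs].
  { intros k; apply Ha, pw_pos. }
  pose proof HN as (_ & _ & _ & _ & _ & Hcomp & _).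
  destruct (Hcomp (fun k => b (s k))) as [y Hy].
  { intros e He; destruct (eventually_pw e He) as [K HK]; exists K; intros k k' Hk Hk'.
    rewrite <- Hd; pose proof (tame_tri M TM (a (s k)) x (a (s k'))).
    rewrite (tame_sym M TM x) in H; pose proof (Hs k); pose proof (Hs k').
    pose proof (pw_le K k Hk); pose proof (pw_le K k' Hk'); specialize (HK K ltac:(lia)); lra. }
  exists y; intros e He; destruct (Hy e He) as [K HK].
  destruct (pw_small_ge e K He) as [k [Hk Hke]].
  exists (s k); split; [specialize (Hs k); lra|now apply HK].
Qed.

Section Extension.
Context {L : signature} (M N : structure L) (HM : polish M) (HN : polish N).
Context (a : nat -> M) (b : nat -> N).
Context (Ha : forall z e, 0 < e -> exists i, dist M (a i) z < e).
Context (Hb : forall z e, 0 < e -> exists i, dist N (b i) z < e).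
Context (Hd : forall i j, dist M (a i) (a j) = dist N (b i) (b j)).
Context (Hi : forall P (v : Fin.t (arity L P) -> nat),
  interp M P (fun k => a (v k)) = interp N P (fun k => b (v k))).

Let TM : tame M := polish_tame M HM.
Let TN : tame N := polish_tame N HN.

Lemma dist_squeeze (x x' : M) (y y' : N) :
  (forall e, 0 < e -> exists i, dist M (a i) x < e /\ dist N (b i) y < e) ->
  (forall e, 0 < e -> exists i, dist M (a i) x' < e /\ dist N (b i) y' < e) ->
  dist N y y' = dist M x x'.
Proof.
  intros H H'; apply cond_eq; intros e He.
  destruct (H (e / 4) ltac:(lra)) as [i [H1 H2]].
  destruct (H' (e / 4) ltac:(lra)) as [j [H3 H4]].
  pose proof (dist_perturb M TM x x' (a i) (a j) (e / 4)) as P1.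
  pose proof (dist_perturb N TN y y' (b i) (b j) (e / 4)) as P2.
  rewrite Hd in P1; rewrite (tame_sym M TM x), (tame_sym M TM x') in P1.
  rewrite (tame_sym N TN y), (tame_sym N TN y') in P2.
  specialize (P1 H1 H3); specialize (P2 H2 H4).
  apply Rabs_def2 in P1; apply Rabs_def2 in P2.
  apply Rabs_def1; lra.
Qed.

Lemma isomorphic_of_dense : isomorphic M N.
Proof.
  destruct (fun_choice _ (matched_point M N a b TM HN Ha Hd)) as [g Hg]; exists g.
  assert (Hdist : forall x x', dist N (g x) (g x') = dist M x x')
    by (intros x x'; apply dist_squeeze; apply Hg).
  split; [|split; [exact Hdist|]].
  - intros y.
    assert (Hx : exists x, forall e, 0 < e -> exists i, dist M (a i) x < e /\ dist N (b i) y < e).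
    { destruct (matched_point N M b a TN HM Hb) with (x := y) as [x Hx]; [now symmetry|].
      exists x; intros e He; destruct (Hx e He) as [i [H1 H2]]; now exists i. }
    destruct Hx as [x Hx]; exists x.
    pose proof HN as (_ & Hz & _); apply Hz.
    rewrite (dist_squeeze x x (g x) y (Hg x) Hx); apply (tame_refl M TM).
  - intros P v; apply cond_eq; intros e He.
    pose proof (modulus_pos L P (e / 4) ltac:(lra)) as Hm.
    destruct (fun_choice (fun k i => dist M (a i) (v k) < modulus L P (e / 4) /\
      dist N (b i) (g (v k)) < modulus L P (e / 4))) as [s Hs].
    { intros k; now apply Hg. }
    pose proof (tame_cont M TM P (e / 4) (fun k => a (s k)) v ltac:(lra)
      (fun k => proj1 (Hs k))) as C1.
    pose proof (tame_cont N TN P (e / 4) (fun k => b (s k)) (fun k => g (v k)) ltac:(lra)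
      (fun k => proj2 (Hs k))) as C2.
    rewrite Hi in C1.
    apply Rle_lt_trans with (e / 4 + e / 4); [|lra].
    replace (interp N P (fun k => g (v k)) - interp M P v) with
      (- (interp N P (fun k => b (s k)) - interp N P (fun k => g (v k))) +
       (interp N P (fun k => b (s k)) - interp M P v)) by ring.
    eapply Rle_trans; [apply Rabs_triang|]. rewrite Rabs_Ropp; lra.
Qed.
End Extension.

(** * The back-and-forth game *)

(** A relation between pieces written on representatives. An answer to an extension may first move
    the other tuple inside its piece, which is what lets the second side drift. *)
Record bf_system {L} (M N : structure L)
    (G : list label -> list M -> list N -> Prop) : Prop := {
  bf_nil : G [] [] [];
  bf_valid : forall lam x y, G lam x y -> piece M lam x x /\ piece N lam y y;
  bf_class : forall lam x y x' y', G lam x y -> piece M lam x x' -> piece N lam y y' ->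
    G lam x' y';
  bf_fwd : forall l lam b x y, G lam x y -> piece M (l :: lam) (b :: x) (b :: x) ->
    exists c y', piece N lam y y' /\ G (l :: lam) (b :: x) (c :: y');
  bf_bwd : forall l lam c x y, G lam x y -> piece N (l :: lam) (c :: y) (c :: y) ->
    exists b x', piece M lam x x' /\ G (l :: lam) (b :: x') (c :: y) }.

Lemma bf_flip {L} (M N : structure L) G : bf_system M N G ->
  bf_system N M (fun lam y x => G lam x y).
Proof.
  intros [H1 H2 H3 H4 H5]; split; [easy| | | |].
  - intros lam x y H; now apply and_comm, H2.
  - intros lam x y x' y' H Hx Hy; now apply (H3 lam y x).
  - intros l lam c y x H Hc; now apply H5.
  - intros l lam c y x H Hc; now apply H4.
Qed.

Lemma bf_desc {L} (M N : structure L) G : tame M -> tame N -> bf_system M N G ->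
  forall lam x y mu x', G lam x y -> desc M lam x mu x' ->
  exists y', desc N lam y mu y' /\ G (mu ++ lam) x' y'.
Proof.
  intros TM TN B lam x y mu; induction mu as [|l mu IH]; intros x' HG [H1 H2].
  - pose proof (piece_length_l _ _ _ _ H1) as Hl; simpl in H1, Hl.
    rewrite lastn_exact in H2 by easy.
    destruct (bf_valid _ _ _ B _ _ _ HG) as [_ Hy].
    exists y; split; [now apply desc_class|]; now apply (bf_class _ _ _ B _ x y).
  - pose proof (piece_length_l _ _ _ _ H1) as Hl; simpl in Hl; rewrite length_app in Hl.
    destruct x' as [|b x']; [easy|]; simpl in Hl.
    pose proof (piece_tl _ _ _ _ _ H1) as H3; simpl in H3.
    change (b :: x') with ([b] ++ x') in H2; rewrite lastn_app in H2 by lia.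
    destruct (IH x' HG (conj H3 H2)) as [y' [HD HG']].
    destruct (bf_fwd _ _ _ B l _ b _ _ HG' H1) as (c & y2 & Hy2 & HG2).
    exists (c :: y2); split; [|exact HG2].
    apply (desc_trans N TN lam y mu y2 [l]).
    + apply (desc_trans N TN lam y mu y' []); [easy|now apply desc_class].
    + apply desc_child, (bf_valid _ _ _ B _ _ _ HG2).
Qed.

Section Game.
Context {L : signature} (M N : structure L) (HM : polish M) (HN : polish N).
Context (a : nat -> M) (b : nat -> N).
Context (Ha : forall z e, 0 < e -> exists m, dist M (a m) z < e).
Context (Hb : forall z e, 0 < e -> exists m, dist N (b m) z < e).
Context (HTM : tb_dense M) (HTN : tb_dense N).
Context (G : list label -> list M -> list N -> Prop) (B : bf_system M N G).

Let TM : tame M := polish_tame M HM.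
Let TN : tame N := polish_tame N HN.

Record state : Type := State {
  st_lam : list label; st_x : list M; st_y : list N; st_n : nat }.

(** Stability at some scale [d >= t] on both sides is what allows stage [t] to move the controlled
    coordinates by less than [pw t]. *)
Definition inv (t : nat) (s : state) : Prop :=
  (st_n s <= length (st_lam s))%nat /\ G (st_lam s) (st_x s) (st_y s) /\
  (exists d, (t <= d)%nat /\ stable M (st_n s) d (st_lam s) (st_x s)) /\
  (exists d, (t <= d)%nat /\ stable N (st_n s) d (st_lam s) (st_y s)).

Definition next (tau : task) (t : nat) (s s' : state) : Prop :=
  exists mu, st_lam s' = mu ++ st_lam s /\ (0 < length mu)%nat /\
    st_n s' = length (st_lam s) /\
    desc M (st_lam s) (st_x s) mu (st_x s') /\ desc N (st_lam s) (st_y s) mu (st_y s') /\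
    close M (pw t) (lastn (st_n s) (st_x s)) (lastn (st_n s) (st_x s')) /\
    close N (pw t) (lastn (st_n s) (st_y s)) (lastn (st_n s) (st_y s')) /\
    (exists u, (length (st_lam s) <= length u)%nat /\
      close M (pw t) (lastn (st_n s) (st_x s)) (lastn (st_n s) u) /\
      done M a tau u (st_lam s') (st_x s')) /\
    (exists u, (length (st_lam s) <= length u)%nat /\
      close N (pw t) (lastn (st_n s) (st_y s)) (lastn (st_n s) u) /\
      done N b tau u (st_lam s') (st_y s')).

Lemma recentre {K : structure L} (TK : tame K) n d t lam x mu x' :
  (n <= length lam)%nat -> (t <= d)%nat -> piece K lam x x -> stable K n d lam x ->
  desc K lam x mu x' ->
  exists x'', piece K (mu ++ lam) x' x'' /\ close K (pw t) (lastn n x) (lastn n x'').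
Proof.
  intros Hn Ht Hx HS HD; pose proof (piece_length_l _ _ _ _ Hx) as Hl.
  destruct (HS mu x' HD (lastn n x)) as (l & [Hll [e He]] & Hc).
  { apply proj_lastn; [easy|lia]. }
  exists (e ++ l); split; [easy|]; rewrite lastn_app, (lastn_exact n l) by lia.
  apply close_mono with (2 := Hc); now apply pw_le.
Qed.

(** The task is done on each side and answered on the other, then both sides are stabilised for all
    [length lam] coordinates present at the start. Stability inherited from the previous stage
    applies to the final piece however long the detour, so both tuples are recentred at the end. *)
Lemma game_step tau t s : inv t s -> exists s', inv (S t) s' /\ next tau t s s'.
Proof.
  destruct s as [lam x y n]; intros (Hn & HG & [d1 [Hd1 S1]] & [d2 [Hd2 S2]]); simpl in *.
  destruct (bf_valid _ _ _ B _ _ _ HG) as [Vx Vy].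
  destruct (do_task M TM a tau lam x HTM Vx) as (mu1 & x1 & Dx1 & T1).
  destruct (bf_desc M N G TM TN B _ _ _ _ _ HG Dx1) as (y1 & Dy1 & G1).
  (* The answer [y1] may have drifted; the task on [N] must concern a tuple close to [y], hence this
     early recentring. *)
  destruct (recentre TN n d2 t lam y mu1 y1 Hn Hd2 Vy S2 Dy1) as (y1' & Py1 & Cy1).
  pose proof (bf_flip M N G B) as B'.
  assert (Dy1' : desc N lam y mu1 y1')
    by (apply (desc_trans N TN lam y mu1 y1 []); [easy|now apply desc_class]).
  assert (G1' : G (mu1 ++ lam) x1 y1')
    by (apply (bf_class _ _ _ B _ x1 y1); [easy|apply Dx1|easy]).
  destruct (do_task N TN b tau (mu1 ++ lam) y1' HTN) as (mu2 & y2 & Dy2 & T2); [apply Dy1'|].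
  destruct (bf_desc N M _ TN TM B' _ _ _ _ _ G1' Dy2) as (x2 & Dx2 & G2).
  set (lam2 := mu2 ++ mu1 ++ lam) in *.
  assert (Hlam2 : (length lam <= length lam2)%nat) by (unfold lam2; rewrite !length_app; lia).
  destruct (stabilise M TM (a O) lam2 x2 (length lam) (S t)) as (d3 & mu3 & x3 & Hd3 & Dx3 & Hmu3 & S3);
    [easy|apply Dx2|easy|].
  destruct (bf_desc M N G TM TN B _ _ _ _ _ G2 Dx3) as (y3 & Dy3 & G3).
  destruct (stabilise N TN (b O) (mu3 ++ lam2) y3 (length lam) (S t))
    as (d4 & mu4 & y4 & Hd4 & Dy4 & Hmu4 & S4);
    [easy|apply Dy3|rewrite length_app; lia|].
  destruct (bf_desc N M _ TN TM B' _ _ _ _ _ G3 Dy4) as (x4 & Dx4 & G4).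
  set (lam4 := mu4 ++ mu3 ++ lam2) in *.
  assert (Dx : desc M lam x (mu4 ++ mu3 ++ mu2 ++ mu1) x4).
  { pose proof (desc_trans M TM _ _ _ _ _ _ Dx1 Dx2) as D1; unfold lam2 in *.
    rewrite (app_assoc mu2) in Dx3, Dx4.
    pose proof (desc_trans M TM _ _ _ _ _ _ D1 Dx3) as D2.
    rewrite (app_assoc mu3) in Dx4; exact (desc_trans M TM _ _ _ _ _ _ D2 Dx4). }
  assert (Dy : desc N lam y (mu4 ++ mu3 ++ mu2 ++ mu1) y4).
  { pose proof (desc_trans N TN _ _ _ _ _ _ Dy1' Dy2) as D1; unfold lam2 in *.
    rewrite (app_assoc mu2) in Dy3, Dy4.
    pose proof (desc_trans N TN _ _ _ _ _ _ D1 Dy3) as D2.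
    rewrite (app_assoc mu3) in Dy4; exact (desc_trans N TN _ _ _ _ _ _ D2 Dy4). }
  assert (El : (mu4 ++ mu3 ++ mu2 ++ mu1) ++ lam = lam4)
    by (unfold lam4, lam2; now rewrite <- !app_assoc).
  destruct (recentre TM n d1 t lam x _ x4 Hn Hd1 Vx S1 Dx) as (x5 & Px5 & Cx5).
  destruct (recentre TN n d2 t lam y _ y4 Hn Hd2 Vy S2 Dy) as (y5 & Py5 & Cy5).
  rewrite El in Px5, Py5.
  assert (Dx5 : desc M lam4 x4 [] x5) by now apply desc_class.
  assert (Dy5 : desc N lam4 y4 [] y5) by now apply desc_class.
  exists (State lam4 x5 y5 (length lam)); split.
  - split; [simpl; rewrite <- El, length_app; lia|].
    split; [now apply (bf_class _ _ _ B _ x4 y4)|]; split; simpl.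
    + exists d3; split; [easy|].
      apply (stable_desc M TM (length lam) d3 lam4 x4 []);
        [rewrite <- El, length_app; lia| |easy].
      apply (stable_desc M TM (length lam) d3 (mu3 ++ lam2) x3 mu4);
        [rewrite length_app; lia|easy|easy].
    + exists d4; split; [easy|].
      apply (stable_desc N TN (length lam) d4 lam4 y4 []);
        [rewrite <- El, length_app; lia|easy|easy].
  - exists (mu4 ++ mu3 ++ mu2 ++ mu1); simpl.
    split; [easy|]; split; [rewrite length_app; lia|]; split; [easy|].
    split; [apply (desc_trans M TM _ _ (mu4 ++ mu3 ++ mu2 ++ mu1) x4 []); [easy|now rewrite El]|].
    split; [apply (desc_trans N TN _ _ (mu4 ++ mu3 ++ mu2 ++ mu1) y4 []); [easy|now rewrite El]|].
    split; [easy|]; split; [easy|]; split.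
    + exists x; split; [apply piece_length_l in Vx; lia|].
      split; [apply close_refl; [exact TM|apply pw_pos]|].
      apply (done_desc M TM a tau x lam4 x4 []); [|easy].
      apply (done_desc M TM a tau x (mu3 ++ lam2) x3); [|easy].
      apply (done_desc M TM a tau x lam2 x2); [|easy].
      now apply (done_desc M TM a tau x (mu1 ++ lam) x1).
    + exists y1'; split.
      { apply (piece_length_r N TN) in Py1; rewrite Py1, length_app; lia. }
      split; [easy|].
      apply (done_desc N TN b tau y1' lam4 y4 []); [|easy].
      apply (done_desc N TN b tau y1' (mu3 ++ lam2) y3); [|easy].
      now apply (done_desc N TN b tau y1' lam2 y2).
Qed.

Lemma stable_zero (K : structure L) d lam x : stable K O d lam x.
Proof.
  intros mu x' [HD _] l [Hl _]; apply length_zero_iff_nil in Hl; subst l.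
  exists []; split; [|constructor]; split; [easy|]; exists x'; now rewrite app_nil_r.
Qed.

Lemma game_start : exists s, inv O s.
Proof.
  exists (State [] [] [] O); split; [easy|]; split; [apply (bf_nil _ _ _ B)|].
  split; exists O; (split; [easy|apply stable_zero]).
Qed.

(** Labels and tasks hold index lists of no prescribed arity. *)
Lemma fin_list m (v : Fin.t m -> nat) : exists vl,
  forall k, nth (proj1_sig (Fin.to_nat k)) vl O = v k /\ In (v k) vl.
Proof.
  induction m as [|m IH]; [exists []; intros k; inversion k|].
  destruct (IH (fun k => v (Fin.FS k))) as [vl Hvl]; exists (v Fin.F1 :: vl).
  intros k; apply (Fin.caseS' k); [simpl; auto|]; intros k'; simpl.
  destruct (Hvl k') as [H1 H2]; split; [|now right].
  destruct (Fin.to_nat k') as [i Hi]; exact H1.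
Qed.

Lemma near_both p q u v c : near u p q c -> near v p q c -> Rabs (u - v) < 2 * pw c.
Proof.
  unfold near; intros H1 H2; apply Rabs_def2 in H1; apply Rabs_def2 in H2.
  apply Rabs_def1; lra.
Qed.

Theorem bf_isomorphic : isomorphic M N.
Proof.
  destruct (countable_enum (Tnear 0 0) countable_task) as [sched Hsched].
  destruct game_start as [s0 Hs0].
  set (stp := fun t (s : {s | inv t s}) => constructive_indefinite_description _
    (game_step (sched t) t (proj1_sig s) (proj2_sig s))).
  set (run_ := fix run_ t : {s | inv t s} := match t with
    | O => exist _ s0 Hs0
    | S t => exist _ (proj1_sig (stp t (run_ t))) (proj1 (proj2_sig (stp t (run_ t)))) end).
  set (st := fun t => proj1_sig (run_ t)).
  assert (Hinv : forall t, inv t (st t)) by (intros t; apply (proj2_sig (run_ t))).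
  assert (Hnext : forall t, next (sched t) t (st t) (st (S t)))
    by (intros t; apply (proj2_sig (stp t (run_ t)))).
  clearbody st; clear stp run_ s0 Hs0.
  set (lam := fun t => st_lam (st t)); set (x := fun t => st_x (st t));
  set (y := fun t => st_y (st t)); set (n := fun t => st_n (st t)).
  assert (RM : run M a sched lam x n).
  { split; intros t; pose proof (Hinv t) as (I1 & I2 & _);
      pose proof (Hnext t) as (mu & N1 & N2 & N3 & N4 & N5 & N6 & N7 & N8 & N9);
      unfold lam, x, n; try easy.
    - apply (bf_valid _ _ _ B _ _ _ I2).
    - now exists mu.
    - rewrite N1, length_app; lia. }
  assert (RN : run N b sched lam y n).
  { split; intros t; pose proof (Hinv t) as (I1 & I2 & _);
      pose proof (Hnext t) as (mu & N1 & N2 & N3 & N4 & N5 & N6 & N7 & N8 & N9);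
      unfold lam, y, n; try easy.
    - apply (bf_valid _ _ _ B _ _ _ I2).
    - now exists mu.
    - rewrite N1, length_app; lia. }
  destruct (run_limit M HM a sched lam x n RM) as [l Hl].
  destruct (run_limit N HN b sched lam y n RN) as [r Hr].
  (* The factor 3 replaces 2 to make the inequality strict, as perturbation and continuity moduli
     require. *)
  assert (Hl3 : forall i t, (i < n t)%nat -> dist M (coord M a (x t) i) (l i) < 3 * pw t)
    by (intros i t Hi; pose proof (Hl i t Hi); pose proof (pw_pos t); lra).
  assert (Hr3 : forall i t, (i < n t)%nat -> dist N (coord N b (y t) i) (r i) < 3 * pw t)
    by (intros i t Hi; pose proof (Hr i t Hi); pose proof (pw_pos t); lra).
  apply (isomorphic_of_dense M N HM HN l r).
  - intros z e; apply (run_dense M HM a Ha sched Hsched lam x n RM l Hl).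
  - intros z e; apply (run_dense N HN b Hb sched Hsched lam y n RN r Hr).
  (* The branches share their labels, so one [Tdist] task yields the same dyadic approximation on
     both sides. The total error is below [2 * pw c + 12 * pw t'], hence below [14 / 20] of [e]. *)
  - intros i j; apply cond_eq; intros e He.
    destruct (pw_small (e / 20) ltac:(lra)) as [c Hc].
    destruct (eventually_and _ _ (run_n_grows M a sched lam x n RM i)
      (run_n_grows M a sched lam x n RM j)) as [N0 HN0].
    destruct (Hsched (Tdist i j c) N0) as [t [Ht Et]].
    destruct (HN0 t Ht) as [Hi Hj].
    destruct (run_done _ _ _ _ _ _ RM t) as (u & Hu & _ & Hdone); rewrite Et in Hdone.
    pose proof (run_le _ _ _ _ _ _ RM t) as Hle.
    destruct Hdone as (mu & lam1 & p & q & E & Hlen); [lia|lia|].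
    destruct (pw_small_ge (e / 20) (S t) ltac:(lra)) as [t' [Ht' Hpt]].
    destruct (run_desc_le M HM a sched lam x n RM (S t) t' Ht') as [mu' [E' _]].
    rewrite E, app_assoc in E'.
    pose proof (run_valid _ _ _ _ _ _ RM t') as VM; rewrite E' in VM.
    pose proof (run_valid _ _ _ _ _ _ RN t') as VN; rewrite E' in VN.
    destruct (label_persists M TM a _ _ _ _ VM) as (b1 & u1 & _ & _ & C1 & G1).
    destruct (label_persists N TN b _ _ _ _ VN) as (b2 & u2 & _ & _ & C2 & G2).
    cbn [cond] in C1, C2; rewrite !G1 in C1 by lia; rewrite !G2 in C2 by lia.
    pose proof (near_both _ _ _ _ _ C1 C2) as HB.
    pose proof (run_n_mono M a sched lam x n RM t t' ltac:(lia)) as Hnt.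
    pose proof (dist_perturb M TM _ _ _ _ _ (Hl3 i t' ltac:(lia)) (Hl3 j t' ltac:(lia))) as P1.
    pose proof (dist_perturb N TN _ _ _ _ _ (Hr3 i t' ltac:(lia)) (Hr3 j t' ltac:(lia))) as P2.
    apply Rabs_def2 in P1, P2, HB; apply Rabs_def1; lra.
  - intros P v; apply cond_eq; intros e He.
    destruct (pw_small (e / 10) ltac:(lra)) as [c Hc].
    destruct (fin_list _ v) as [vl Hv].
    assert (Hvl := fun k => proj1 (Hv k)).
    assert (Hev : forall vl, eventually (fun t => Forall (fun i => (i < n t)%nat) vl)).
    { clear vl Hv Hvl; induction vl as [|i vl IH]; [exists O; constructor|].
      destruct (eventually_and _ _ (run_n_grows M a sched lam x n RM i) IH) as [N0 HN0].
      exists N0; intros t Ht; destruct (HN0 t Ht); now constructor. }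
    destruct (Hev vl) as [N0 HN0].
    destruct (Hsched (Tpred (pred_code L P) vl c) N0) as [t [Ht Et]].
    specialize (HN0 t Ht).
    assert (Hvn : forall k, (v k < n t)%nat).
    { intros k; rewrite Forall_forall in HN0; apply HN0, Hv. }
    destruct (run_done _ _ _ _ _ _ RM t) as (u & Hu & _ & Hdone); rewrite Et in Hdone.
    pose proof (run_le _ _ _ _ _ _ RM t) as Hle.
    destruct Hdone as (mu & lam1 & p & q & E & Hlen).
    { apply Forall_impl with (2 := HN0); intros i Hi; lia. }
    pose proof (modulus_pos L P (e / 10) ltac:(lra)) as Hmod.
    destruct (pw_small_ge (modulus L P (e / 10) / 3) (S t) ltac:(lra)) as [t' [Ht' Hpt]].
    destruct (run_desc_le M HM a sched lam x n RM (S t) t' Ht') as [mu' [E' _]].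
    rewrite E, app_assoc in E'.
    pose proof (run_valid _ _ _ _ _ _ RM t') as VM; rewrite E' in VM.
    pose proof (run_valid _ _ _ _ _ _ RN t') as VN; rewrite E' in VN.
    destruct (label_persists M TM a _ _ _ _ VM) as (b1 & u1 & _ & _ & C1 & G1).
    destruct (label_persists N TN b _ _ _ _ VN) as (b2 & u2 & _ & _ & C2 & G2).
    specialize (C1 P eq_refl); specialize (C2 P eq_refl).
    replace (fun k : Fin.t (arity L P) => get b1 u1 (nth (proj1_sig (Fin.to_nat k)) vl 0%nat))
      with (fun k => coord M a (x t') (v k)) in C1
      by (extensionality k; rewrite Hvl, G1; [easy|specialize (Hvn k); lia]).
    replace (fun k : Fin.t (arity L P) => get b2 u2 (nth (proj1_sig (Fin.to_nat k)) vl 0%nat))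
      with (fun k => coord N b (y t') (v k)) in C2
      by (extensionality k; rewrite Hvl, G2; [easy|specialize (Hvn k); lia]).
    pose proof (near_both _ _ _ _ _ C1 C2) as HB.
    pose proof (run_n_mono M a sched lam x n RM t t' ltac:(lia)) as Hnt.
    pose proof (tame_cont M TM P (e / 10) (fun k => coord M a (x t') (v k))
      (fun k => l (v k)) ltac:(lra)) as P1.
    pose proof (tame_cont N TN P (e / 10) (fun k => coord N b (y t') (v k))
      (fun k => r (v k)) ltac:(lra)) as P2.
    assert (Hpt3 : 3 * pw t' < modulus L P (e / 10)) by lra.
    assert (Q1 := P1 (fun k => Rlt_trans _ _ _ (Hl3 (v k) t'
      (Nat.lt_le_trans _ _ _ (Hvn k) Hnt)) Hpt3)).
    assert (Q2 := P2 (fun k => Rlt_trans _ _ _ (Hr3 (v k) t'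
      (Nat.lt_le_trans _ _ _ (Hvn k) Hnt)) Hpt3)).
    apply Coquelicot.Rcomplements.Rabs_le_between in Q1, Q2; apply Rabs_def2 in HB; apply Rabs_def1; lra.
Qed.
End Game.

(** * Conclusion *)

(** [K] is a neighbourhood of [y] only within [D], but [D] is dense, so a ball of [M] lies in the
    closure of [K], and a finite cover of [K] by small balls gives a net of it. *)
Lemma alc_tb_dense {L} (M : structure L) : tame M -> almost_locally_compact M -> tb_dense M.
Proof.
  intros T (D & HD & HL) x e He.
  destruct (HD x e He) as [y [Hy Hxy]].
  destruct (HL y Hy) as (K & d & Hd & HK & HKD & HDK).
  destruct (pw_small d Hd) as [r Hr]; exists y, r; split; [easy|]; intros q.
  destruct (HK M (fun c z => dist M c z < pw (S q))) as [F HF].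
  - intros c z Hz; exists (pw (S q) - dist M c z); split; [lra|]; intros z' Hz'.
    pose proof (tame_tri M T c z z'); lra.
  - intros z _; exists z; rewrite (tame_refl M T); apply pw_pos.
  - exists F; intros z Hz.
    destruct (HD z (Rmin (pw (S q)) (d - dist M y z))) as [k [Hk Hzk]].
    { apply Rmin_pos; [apply pw_pos|lra]. }
    pose proof (Rmin_l (pw (S q)) (d - dist M y z)).
    pose proof (Rmin_r (pw (S q)) (d - dist M y z)).
    destruct (HF k) as [c [Hc Hck]].
    { apply HDK; [easy|]; pose proof (tame_tri M T y z k); lra. }
    exists c; split; [easy|].
    pose proof (tame_tri M T c k z); rewrite (tame_sym M T k z) in H1.
    rewrite pw_S in *; lra.
Qed.

(** * From isomorphic trees to isomorphic structures *)

Section Recover.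
Context {L : signature}.

(** The back-and-forth system read off from a map [p] of names: arbitrary tuples are related when
    some [m] names the piece of the first and [p m] that of the second. *)
Definition matched (M N : structure L) (f : nat -> M) (g : nat -> N)
    (p : nat -> nat) (lam : list label) (x : list M) (y : list N) : Prop :=
  exists m, fst (name m) = lam /\ fst (name (p m)) = lam /\
    piece M lam x (map f (snd (name m))) /\ piece N lam y (map g (snd (name (p m)))).

(** The child piece contains a dense tuple, hence has a name, and [p] sends it to a child of the
    matched piece. Only implications are asked of [p], so the inverse bijection gives the backward
    condition. *)
Lemma matched_fwd (c c' : Code L) M N f g p :
  dense_map (cst c) M f -> dense_map (cst c') N g ->
  (forall m, valid c m -> valid c' (p m) /\ fst (name (p m)) = fst (name m)) ->
  (forall m m', child c m m' -> child c' (p m) (p m')) ->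
  forall l lam b x y, matched M N f g p lam x y ->
  piece M (l :: lam) (b :: x) (b :: x) ->
  exists d y', piece N lam y y' /\ matched M N f g p (l :: lam) (b :: x) (d :: y').
Proof.
  intros Df Dg Hlab Hch l lam b x y (m & E1 & E2 & Px & Py) Hb.
  pose proof (dm_tame _ _ _ Df) as TM; pose proof (dm_tame _ _ _ Dg) as TN.
  destruct (dense_in_piece (cst c) M f _ _ Df Hb) as [s Hs].
  destruct (name_surj (l :: lam, s) O) as [m' [_ Hm']].
  assert (V : valid c m).
  { unfold valid; apply (piece_transfer (cst c) M f Df); rewrite E1.
    now apply piece_refl_r with x. }
  assert (V' : valid c m').
  { unfold valid; apply (piece_transfer (cst c) M f Df); rewrite Hm'; simpl fst; simpl snd.
    now apply (piece_refl_r M TM) with (b :: x). }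
  assert (C : child c m m').
  { split; [easy|]; split; [easy|]; rewrite Hm', E1; simpl fst; simpl snd.
    split; [easy|]; split; [easy|].
    apply (piece_transfer (cst c) M f Df).
    apply piece_trans with x; [now apply piece_sym|].
    apply piece_tl in Hs; simpl in Hs. now destruct s. }
  destruct (Hlab m' V') as [W' E']; rewrite Hm' in E'; simpl in E'.
  destruct (Hch m m' C) as (_ & _ & _ & _ & Hp).
  unfold valid in W'; apply (piece_transfer (cst c') N g Dg) in W', Hp.
  rewrite E' in W'; rewrite E2 in Hp.
  pose proof (piece_length_l _ _ _ _ W') as Hlen.
  destruct (snd (name (p m'))) as [|d s'] eqn:Es; [easy|].
  exists (g d), (map g s'); split; [now apply piece_trans with (1 := Py)|].
  exists m'; rewrite Hm', E', Es; exact (conj eq_refl (conj eq_refl (conj Hs W'))).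
Qed.

Lemma ciso_isomorphic (c c' : Code L) (M N : structure L) a b :
  codes c M a -> codes c' N b -> almost_locally_compact M -> almost_locally_compact N ->
  ciso (classify c) (classify c') -> isomorphic M N.
Proof.
  intros Hc Hc' AM AN (p & q & Hqp & Hpq & Hiso).
  pose proof (codes_dense_map c M a Hc) as Da; pose proof (codes_dense_map c' N b Hc') as Db.
  pose proof (dm_tame _ _ _ Da) as TM; pose proof (dm_tame _ _ _ Db) as TN.
  assert (Hlab : forall lam m, labelled c' lam (p m) <-> labelled c lam m).
  { intros lam m; specialize (Hiso (Some lam) (fun _ => m)).
    apply Bool.eq_iff_eq_true in Hiso; rewrite !classify_true in Hiso; exact Hiso. }
  assert (Hch : forall m m', child c' (p m) (p m') <-> child c m m').
  { intros m m'; specialize (Hiso None (fun k => match k with Fin.F1 _ => m | _ => m' end)).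
    apply Bool.eq_iff_eq_true in Hiso; rewrite !classify_true in Hiso; exact Hiso. }
  apply (bf_isomorphic M N (proj1 Hc) (proj1 Hc') a b) with (G := matched M N a b p).
  - intros z e He; destruct Hc as (_ & H & _); destruct (H O z e He) as [m [_ Hm]]; now exists m.
  - intros z e He; destruct Hc' as (_ & H & _); destruct (H O z e He) as [m [_ Hm]]; now exists m.
  - now apply alc_tb_dense.
  - now apply alc_tb_dense.
  - split.
    + destruct (name_surj ([], []) O) as [m [_ Hm]]; exists m.
      assert (Hl : labelled c [] m) by (unfold labelled, valid; rewrite Hm; easy).
      apply Hlab in Hl; destruct Hl as [E V]; unfold valid in V; rewrite E in V.
      destruct V as [V _]; rewrite Hm, E, V; easy.
    + intros lam x y (m & _ & _ & H1 & H2); split; eapply piece_refl_l; eassumption.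
    + intros lam x y x' y' (m & E1 & E2 & H1 & H2) Hx Hy; exists m; split; [easy|].
      split; [easy|]; split.
      * apply piece_trans with x; [now apply piece_sym|easy].
      * apply piece_trans with y; [now apply piece_sym|easy].
    + apply (matched_fwd c c'); [easy|easy| |].
      * intros m V; assert (Hl : labelled c (fst (name m)) m) by now split.
        apply Hlab in Hl; destruct Hl; now split.
      * intros m m'; apply Hch.
    + intros l lam d x y (m & E1 & E2 & H1 & H2) Hd.
      destruct (matched_fwd c' c N M b a q Db Da) with (l := l) (lam := lam) (b := d)
        (x := y) (y := x) as (e & x' & Hx' & m' & F1 & F2 & F3 & F4).
      * intros m' V; assert (Hl : labelled c' (fst (name m')) (p (q m')))
          by (rewrite Hpq; now split).
        apply Hlab in Hl; destruct Hl; now split.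
      * intros m1 m2 H; apply Hch; now rewrite !Hpq.
      * exists (p m); rewrite Hqp; easy.
      * easy.
      * exists e, x'; split; [easy|]; exists (q m'); rewrite Hpq; easy.
Qed.
End Recover.

Theorem theorem3p6 (L : signature) (F T : formula L -> Prop) :
  fragment F -> F_theory F T ->
  (forall M : structure L, models M T -> almost_locally_compact M) ->
  classifiable_by_countable_structures (ModT T) (@isoT L).
Proof.
  intros _ _ Halc; exists sym_lang, classify; split.
  - intros B HB; exists (fun c => B (classify c)); split; [now apply classify_borel|easy].
  - intros c c' (M & a & Hc & HMT) (N & b & Hc' & HNT); split; [apply isoT_ciso|].
    intros H; exists M, N, a, b; split; [easy|]; split; [easy|].
    apply (ciso_isomorphic c c' M N a b); auto.
Qed.
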